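(* Let $K\in L_2(\mathbb R)$ be a kernel (satisfying the standing assumptions below) such that $S_K=T_K$. Then the following are equivalent: (i) $S_K>0$; (ii) there exists a probability density $f\in L_2(\mathbb R)$ such that $\Phi(n,f,K)$ is of exact order $n^{-1}$.
   Context: A kernel is an integrable function $K:\mathbb R\to\mathbb R$ with $\int K=1$; standing assumptions: $K$ is bounded, continuous at $0$, and $\int K^2<2K(0)$. For a sample $X_1,\dots,X_n$ i.i.d. with density $f$ on $\mathbb R$, bandwidth $h>0$, the kernel density estimator is $f_{n,K,h}(x)=\frac1n\sum_{i=1}^n K_h(x-X_i)$ with $K_h(x)=K(x/h)/h$. $\mathrm{MISE}_f(f_{n,K,h})=E_f\int (f_{n,K,h}(x)-f(x))^2dx$, and $\Phi(n,f,K)=\min_{h>0}\mathrm{MISE}_f(f_{n,K,h})$ (the minimum exists under the standing assumptions). $\varphi_K(t)=\int e^{itx}K(x)\,dx$ is the characteristic function (Fourier transform) of $K$. $S_K=\inf\{t\ge0: |\varphi_K(t)-1|\ne0\}$ (the largest $r$ with $\varphi_K\equiv1$ on $[0,r]$), and $T_K=\inf\{r\ge0: |\varphi_K(t)-1|\ne0 \text{ for a.e. } t\ge r\}$. ''$\Phi(n,f,K)$ is of exact order $n^{-1}$'' means there exist constants $0<c\le C<\infty$ and $n_0$ such that $c/n\le\Phi(n,f,K)\le C/n$ for all $n\ge n_0$. *)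

(* Defs.v *)
From HB Require Import structures.
From mathcomp Require Import all_boot all_order all_algebra.
From mathcomp Require Import all_classical all_reals all_analysis.
Set Implicit Arguments. Unset Strict Implicit. Unset Printing Implicit Defensive.
Import Order.TTheory GRing.Theory Num.Theory.
Import numFieldNormedType.Exports.
Local Open Scope classical_set_scope.
Local Open Scope ring_scope.

Section KDE.
Variable R : realType.
Local Notation leb := (@lebesgue_measure R).

Definition L2 (g : R -> R) : Prop :=
  measurable_fun setT g /\ (\int[leb]_x ((g x) ^+ 2)%R%:E < +oo)%E.

Definition is_kernel (K : R -> R) : Prop :=
  [/\ measurable_fun setT K,
      leb.-integrable setT (EFin \o K),
      (\int[leb]_x (K x)%:E = 1%:E)%E,
      (exists M : R, forall x, `|K x| <= M) &
      ({for 0, continuous K} /\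
       (\int[leb]_x ((K x) ^+ 2)%R%:E < (2 * K 0)%R%:E)%E)].

Definition is_density (f : R -> R) : Prop :=
  [/\ measurable_fun setT f, (forall x, 0 <= f x) &
      (\int[leb]_x (f x)%:E = 1%:E)%E].

(* characteristic function phi_K(t) = int e^{itx} K(x) dx, written by its
   real and imaginary parts: phi_K(t) = charRe K t + i charIm K t *)
Definition charRe (K : R -> R) (t : R) : R := (\int[leb]_x (cos (t * x) * K x))%R.
Definition charIm (K : R -> R) (t : R) : R := (\int[leb]_x (sin (t * x) * K x))%R.

Definition char_ne1 (K : R -> R) (t : R) : Prop :=
  charRe K t <> 1 \/ charIm K t <> 0.

Definition S_K (K : R -> R) : R := inf [set t | 0 <= t /\ char_ne1 K t].
Definition T_K (K : R -> R) : R :=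
  inf [set r | 0 <= r /\ {ae leb, forall t, r <= t -> char_ne1 K t}].

Definition Kh (K : R -> R) (h : R) (x : R) : R := K (x / h) / h.

Definition kde (K : R -> R) (h : R) (s : seq R) (x : R) : R :=
  (size s)%:R^-1 * \sum_(X <- s) Kh K h (x - X).

(* E_f[g(X_1,...,X_n)] for X_i i.i.d. with density f and g >= 0, as the
   iterated integral  int f(x_1) ... int f(x_n) g(x_1,...,x_n) dx_n ... dx_1
   (equal to the integral against the product density, by Tonelli) *)
Fixpoint iid_expect (f : R -> R) (n : nat) (g : seq R -> \bar R) : \bar R :=
  match n with
  | 0 => g [::]
  | n'.+1 => (\int[leb]_x ((f x)%:E * iid_expect f n' (fun s => g (x :: s))))%E
  end.

Definition MISE (n : nat) (f K : R -> R) (h : R) : \bar R :=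
  iid_expect f n (fun s => \int[leb]_x (((kde K h s x - f x) ^+ 2)%R%:E))%E.

(* Phi(n,f,K) = min_{h>0} MISE (the minimum exists, so it equals the inf) *)
Definition Phi (n : nat) (f K : R -> R) : \bar R :=
  ereal_inf [set MISE n f K h | h in [set h : R | 0 < h]].

Definition exact_order_inv_n (u : nat -> \bar R) : Prop :=
  exists c C : R, exists n0 : nat,
    [/\ 0 < c, c <= C &
      forall n : nat, (n0 <= n)%N ->
        ((c / n%:R)%:E <= u n /\ u n <= (C / n%:R)%:E)%E].

End KDE.

(* Main.v *)
Require Import Defs.
From HB Require Import structures.
From mathcomp Require Import all_boot all_order all_algebra.
From mathcomp Require Import all_classical all_reals all_analysis.
From mathcomp Require Import measurable_realfun.
From mathcomp Require Import ring lra.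
Import Order.TTheory GRing.Theory Num.Theory.
Import numFieldNormedType.Exports.
Set Implicit Arguments. Unset Strict Implicit. Unset Printing Implicit Defensive.
Local Open Scope classical_set_scope.
Local Open Scope ring_scope.

(** Write [k = Kh K h] and [G = f * k]. Then the MISE is
    [||G - f||^2 + (||k||^2 - ||G||^2) / n], the second term being nonnegative.

    If [phi_K = 1] on [[0, S_K]], take for [f] a Fejer density, whose
    characteristic function is supported in [[-1, 1]]. At [h = S_K / 2] the bias
    vanishes, so the MISE is at most [||k||^2 / n]; completing a square shows
    that it is at least [(||f||^2 - ||f * f||^2) / n] for every [h].

    Conversely, suppose that [h_n] achieves MISE [O(1/n)]. Boundedness of
    [||k||^2 - ||G||^2] keeps [h_n] away from 0, and
    [||G|| <= ||k|| = ||K|| / sqrt h_n] keeps [h_n] away from infinity since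
    [||G||] tends to [||f|| > 0]. Along a subsequence [h_n] converges to some
    [h > 0] at which the bias vanishes weakly, i.e.
    [phi_K(t h) phi_f(t) = phi_f(t)]. As [phi_f] is nonzero near 0, [phi_K] is 1
    near 0. *)

(** No Plancherel identity enters. Squared norms are compared through pointwise variances
    ([conv_sqr_le]), and characteristic functions arise only by testing [f * k] against bounded
    functions ([conv_fubini]), sines and cosines in particular. In the sufficiency part the lower
    bound must hold even at bandwidths without bias, so it has to come from the variance. The
    constant [||f||^2 - ||f * f||^2] is positive because equality in Young's inequality would make
    [f] constant; this asks for [f] to be positive almost everywhere. A Fejer density combines that
    positivity with a compactly supported characteristic function, and its evenness makes
    convolution with it self-adjoint. In the converse, [K] is only continuous at 0, so [Kh K (h_ n)]
    need not converge pointwise when [h_ n] does. The bandwidth is therefore moved into a continuous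
    test function, as [psi (y + h * u)], where dominated convergence applies. A second obstacle is
    that sines and cosines are not square integrable, while the bias is controlled in [L2]: they are
    reached as limits of damped test functions. *)

Section Substitution.
Variable R : realType.
Local Notation leb := (@lebesgue_measure R).

Lemma measurable_affine (a b : R) : measurable_fun setT (fun x : R => a * x + b).
Proof. by apply: measurable_funD => //; exact: mulrl_measurable. Qed.

(** By uniqueness of Lebesgue measure it suffices to compare lengths on the intervals []c, d]]. A
    negative [a] moves the closed end of the preimage to the left without changing its length. *)
Lemma lebesgue_measure_affine (a b : R) (A : set R) : a != 0 -> measurable A ->
  (leb A = `|a|%:E * pushforward leb (fun x : R => a * x + b)%R A)%E.
Proof.
move=> a0 mA.
pose phi : {mfun measurableTypeR R >-> measurableTypeR R} :=
  HB.pack (fun x : R => a * x + b) (isMeasurableFun.Build _ _ (measurableTypeR R) (measurableTypeR R) _ (@measurable_affine a b)).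
have na : 0 <= `|a| by [].
apply: (lebesgue_measure_unique (mu := mscale (NngNum na) (pushforward leb phi))) mA => /=.
move=> _ [[c d]] _ <-; rewrite /mscale/= /pushforward/=.
have [a_gt0|a_lt0|/eqP] := ltgtP 0 a; last by rewrite eq_sym (negPf a0).
- rewrite (_ : _ @^-1` _ = `](c - b) / a, (d - b) / a]%classic); last first.
    apply/seteqP; split => x /=; rewrite !in_itv/= => /andP[].
      by move=> h1 h2; rewrite ltr_pdivrMr// ler_pdivlMr// mulrC ltrBlDr lerBrDr h1.
    rewrite ltr_pdivrMr// ler_pdivlMr// mulrC => h1 h2.
    by rewrite -ltrBlDr -lerBrDr h1.
  rewrite !lebesgue_measure_itv/= !lte_fin ltr_pM2r ?invr_gt0// ltrD2r.
  case: ifPn => _; last by rewrite mule0.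
  by rewrite -!EFinB -EFinM gtr0_norm//; congr EFin; field.
- rewrite (_ : _ @^-1` _ = `[(d - b) / a, (c - b) / a[%classic); last first.
    apply/seteqP; split => x /=; rewrite !in_itv/= => /andP[].
      by move=> h1 h2; rewrite ltr_ndivlMr// ler_ndivrMr// mulrC ltrBlDr lerBrDr h1 h2.
    rewrite ltr_ndivlMr// ler_ndivrMr// mulrC => h1 h2.
    by rewrite -ltrBlDr -lerBrDr h1 h2.
  rewrite !lebesgue_measure_itv/= !lte_fin ltr_nM2r ?invr_lt0// ltrD2r.
  case: ifPn => _; last by rewrite mule0.
  by rewrite -!EFinB -EFinM ltr0_norm//; congr EFin; field.
Qed.

Lemma ge0_integral_affine (a b : R) (g : R -> \bar R) : a != 0 ->
  measurable_fun setT g -> (forall x, 0 <= g x)%E ->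
  (`|a|%:E * \int[leb]_x g (a * x + b)%R = \int[leb]_x g x)%E.
Proof.
move=> a0 mg g0.
pose phi : {mfun measurableTypeR R >-> measurableTypeR R} :=
  HB.pack (fun x : R => a * x + b) (isMeasurableFun.Build _ _ (measurableTypeR R) (measurableTypeR R) _ (@measurable_affine a b)).
have na : 0 <= `|a| by [].
have mphi : measurable_fun setT phi by [].
have /= <- := @ge0_integral_pushforward _ _ _ _ R phi mphi leb setT g measurableT mg (fun y _ => g0 y).
rewrite -(@ge0_integral_mscale _ _ _ _ _ measurableT (NngNum na))//.
apply: eq_measure_integral => A mA _.
by apply/esym; exact: (lebesgue_measure_affine b a0 mA).
Qed.

Lemma integrable_affine (a b : R) (g : R -> R) : a != 0 ->
  leb.-integrable setT (EFin \o g) ->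
  leb.-integrable setT (EFin \o (fun x => g (a * x + b))).
Proof.
move=> a0 /integrableP[mg ig]; apply/integrableP; split.
  by apply: (measurableT_comp mg); exact: measurable_affine.
have mg' : measurable_fun setT (fun x => `|(g x)%:E|%E) by exact: measurableT_comp.
move: ig; rewrite -(ge0_integral_affine b a0 mg') => [|x]; last exact: abse_ge0.
move=> h.
have -> : (\int[leb]_x `|(g (a * x + b))%:E| =
  `|a|^-1%:E * (`|a|%:E * \int[leb]_x `|(g (a * x + b)%R)%:E|))%E.
  by rewrite muleA -EFinM mulVf ?normr_eq0// mul1e.
by rewrite lte_mul_pinfty.
Qed.

Lemma Rintegral_affine (a b : R) (g : R -> R) : a != 0 ->
  leb.-integrable setT (EFin \o g) ->
  (`|a| * \int[leb]_x g (a * x + b) = \int[leb]_x g x)%R.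
Proof.
move=> a0 ig; have iga := integrable_affine b a0 ig.
rewrite -[X in X * _]/(fine `|a|%:E) -fineM//; last exact: integrable_fin_num.
congr fine.
rewrite integralE [RHS]integralE.
have mg := measurable_int _ ig.
have Ep : ((EFin \o (fun x => g (a * x + b)%R))^\+ = (fun x => (EFin \o g)^\+ (a * x + b)%R))%E.
  by rewrite -[RHS]/((EFin \o g)^\+ \o (fun x => a * x + b)%R)%E -funepos_comp.
have En : ((EFin \o (fun x => g (a * x + b)%R))^\- = (fun x => (EFin \o g)^\- (a * x + b)%R))%E.
  by rewrite -[RHS]/((EFin \o g)^\- \o (fun x => a * x + b)%R)%E -funeneg_comp.
have fp := integrable_pos_fin_num measurableT iga.
have -> : (\int[leb]_x (EFin \o g)^\+ x = `|a|%:E * \int[leb]_x (EFin \o (fun x => g (a * x + b)%R))^\+ x)%E.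
  rewrite Ep ge0_integral_affine//; exact: measurable_funepos.
have -> : (\int[leb]_x (EFin \o g)^\- x = `|a|%:E * \int[leb]_x (EFin \o (fun x => g (a * x + b)%R))^\- x)%E.
  rewrite En ge0_integral_affine//; exact: measurable_funeneg.
rewrite -muleBr//.
exact: fin_num_adde_defr.
Qed.

End Substitution.

(** * Fubini's theorem for real-valued integrals *)

Section RealFubini.
Variable R : realType.
Local Notation leb := (@lebesgue_measure R).

Lemma integrable_le (g f : R -> R) : measurable_fun setT f ->
  (forall x, `|f x| <= g x) -> leb.-integrable setT (EFin \o g) ->
  leb.-integrable setT (EFin \o f).
Proof.
move=> mf fg; apply: le_integrable => //; first exact/measurable_EFinP.
by move=> x _; rewrite /= lee_fin (le_trans (fg x))// ler_norm.
Qed.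

Lemma integrable_ge0P (g : R -> R) : measurable_fun setT g -> (forall x, 0 <= g x) ->
  (\int[leb]_x (g x)%:E < +oo)%E -> leb.-integrable setT (EFin \o g).
Proof.
move=> mg g0 h; apply/integrableP; split; first exact/measurable_EFinP.
by under eq_integral do rewrite /= ger0_norm//.
Qed.

Lemma EFin_Rintegral (g : R -> R) : leb.-integrable setT (EFin \o g) ->
  (\int[leb]_x g x)%:E = (\int[leb]_x (g x)%:E)%E.
Proof. by move=> ig; rewrite /Rintegral fineK//; exact: integrable_fin_num. Qed.

(* All sections being integrable (not just almost all of them), the inner
   real-valued integrals are never the junk value of [fine] at infinity. *)
Lemma Rfubini (F : R -> R -> R) (B : R -> R) :
  measurable_fun setT (fun z : R * R => F z.1 z.2) ->
  (forall x, leb.-integrable setT (EFin \o F x)) ->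
  (forall y, leb.-integrable setT (EFin \o F ^~ y)) ->
  (forall y, \int[leb]_x `|F x y| <= B y) ->
  leb.-integrable setT (EFin \o B) ->
  [/\ \int[leb]_x \int[leb]_y F x y = \int[leb]_y \int[leb]_x F x y,
      leb.-integrable setT (EFin \o (fun x => \int[leb]_y F x y)) &
      leb.-integrable setT (EFin \o (fun y => \int[leb]_x F x y))].
Proof.
move=> mF iF1 iF2 FB iB.
have mF' : measurable_fun setT (fun z : R * R => (F z.1 z.2)%:E).
  exact/measurable_EFinP.
have iF : (leb \x leb)%E.-integrable setT (fun z : R * R => (F z.1 z.2)%:E).
  apply/integrable21ltyP => //=.
  apply: le_lt_trans (integrable_lty measurableT iB).
  apply: ge0_le_integral => //.
  - by move=> y _; exact: integral_ge0.
  - apply: (measurable_fun_fubini_tonelli_G (m1 := leb) (fun z : R * R => `|(F z.1 z.2)%:E|%E)) => //.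
    exact: measurableT_comp.
  - exact: measurable_int iB.
  - move=> y _; rewrite /= -EFin_Rintegral ?lee_fin ?FB//.
    exact: integrable_norm (iF2 y).
have E1 : EFin \o (fun x => \int[leb]_y F x y) = (fun x => \int[leb]_y (F x y)%:E)%E.
  by apply/funext => x /=; rewrite EFin_Rintegral.
have E2 : EFin \o (fun y => \int[leb]_x F x y) = (fun y => \int[leb]_x (F x y)%:E)%E.
  by apply/funext => x /=; rewrite (EFin_Rintegral (iF2 x)).
split.
- rewrite /Rintegral; congr fine.
  have := Fubini iF; rewrite /= => H.
  transitivity (\int[leb]_x \int[leb]_y (F x y)%:E)%E.
    by apply: eq_integral => x _; rewrite -[LHS]/((EFin \o (fun x => \int[leb]_y F x y)) x) E1.
  rewrite H.
  by apply: eq_integral => y _; rewrite -[RHS]/((EFin \o (fun y => \int[leb]_x F x y)) y) E2.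
- rewrite E1; exact: (integrable_fubini_F iF).
- rewrite E2.
  have := integrable_fubini_F (m1 := leb) (m2 := leb) (f := fun z : R * R => (F z.2 z.1)%:E).
  apply.
  apply/integrable12ltyP => //=; first exact: (measurableT_comp mF' (@measurable_swap _ _ _ _)).
  by have [+ _] := integrable21ltyP leb leb mF'; apply.
Qed.

End RealFubini.

(** * Convolution of an integrable function with a bounded integrable one *)

Section Convolution.
Variable R : realType.
Local Notation leb := (@lebesgue_measure R).
Implicit Types f g k psi : R -> R.

Lemma integrable_measurable g :
  leb.-integrable setT (EFin \o g) -> measurable_fun setT g.
Proof. by move=> /measurable_int/measurable_EFinP. Qed.

Lemma integrable_mul_bounded g psi (N : R) : leb.-integrable setT (EFin \o g) ->
  measurable_fun setT psi -> (forall x, `|psi x| <= N) ->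
  leb.-integrable setT (EFin \o (fun x => g x * psi x)).
Proof.
move=> ig mpsi psiN.
have -> : EFin \o (fun x => g x * psi x) = ((EFin \o g) \* (EFin \o psi))%E.
  by apply/funext => x; rewrite /= EFinM.
apply: integrableMl => //; exists N; split; first exact: num_real.
by move=> M NM x _; exact: le_trans (psiN x) (ltW NM).
Qed.

Lemma integrable_scale g (c : R) : leb.-integrable setT (EFin \o g) ->
  leb.-integrable setT (EFin \o (fun x => g x * c)).
Proof. by move=> ig; apply: (@integrable_mul_bounded _ (cst c) `|c|). Qed.

Lemma integrable_add f g : leb.-integrable setT (EFin \o f) ->
  leb.-integrable setT (EFin \o g) ->
  leb.-integrable setT (EFin \o (fun x => f x + g x)).
Proof. by move=> i1 i2; apply: eq_integrable (integrableD measurableT i1 i2). Qed.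

Lemma integrable_sub f g : leb.-integrable setT (EFin \o f) ->
  leb.-integrable setT (EFin \o g) ->
  leb.-integrable setT (EFin \o (fun x => f x - g x)).
Proof. by move=> i1 i2; apply: eq_integrable (integrableB measurableT i1 i2). Qed.

Lemma measurable_reflect k (x : R) : measurable_fun setT k ->
  measurable_fun setT (fun y : R => k (x - y)).
Proof.
by move=> mk; apply: (measurableT_comp mk); apply: measurable_funB.
Qed.

Lemma integrable_shift k (y : R) : leb.-integrable setT (EFin \o k) ->
  leb.-integrable setT (EFin \o (fun x => k (x - y))).
Proof.
move=> /(integrable_affine (- y) (oner_neq0 R)).
by apply: eq_integrable => // x _; rewrite /= mul1r.
Qed.

Lemma Rintegral_shift k (y : R) : leb.-integrable setT (EFin \o k) ->
  \int[leb]_x k (x - y) = \int[leb]_x k x.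
Proof.
move=> ik; rewrite -(Rintegral_affine (- y) (oner_neq0 R) ik) normr1 mul1r.
by apply: eq_Rintegral => x _; rewrite mul1r.
Qed.

Lemma Rintegral_reflect k (x : R) : leb.-integrable setT (EFin \o k) ->
  \int[leb]_y k (x - y) = \int[leb]_y k y.
Proof.
move=> ik; have a0 : -1 != 0 :> R by rewrite oppr_eq0 oner_eq0.
rewrite -(Rintegral_affine x a0 ik) normrN1 mul1r.
by apply: eq_Rintegral => y _; rewrite mulN1r addrC.
Qed.

Definition conv f k (x : R) : R := \int[leb]_y (f y * k (x - y)).

Lemma convC f k x : leb.-integrable setT (EFin \o (fun y => f y * k (x - y))) ->
  conv f k x = conv k f x.
Proof.
move=> ifk; rewrite /conv -(Rintegral_reflect x ifk).
by apply: eq_Rintegral => y _; rewrite subKr mulrC.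
Qed.

Variables (f k : R -> R) (M : R).
Hypotheses (intf : leb.-integrable setT (EFin \o f))
  (intk : leb.-integrable setT (EFin \o k)) (kM : forall x, `|k x| <= M).

Let mf : measurable_fun setT f := integrable_measurable intf.
Let mk : measurable_fun setT k := integrable_measurable intk.

Lemma integrable_conv_integrand x :
  leb.-integrable setT (EFin \o (fun y => f y * k (x - y))).
Proof.
by apply: (integrable_mul_bounded (N := M)) => //; exact: measurable_reflect.
Qed.

(** Duality for convolution; the [L1] norms of the sections are bounded by [|f y| * N * ||k||_1].
    The choice [psi = 1] gives integrability and mass of [f * k], [psi = k] an inner product in
    [risk_ge], and later [psi] is a cosine or a sine. *)
Lemma conv_fubini psi (N : R) : measurable_fun setT psi -> (forall x, `|psi x| <= N) ->
  [/\ \int[leb]_x (conv f k x * psi x) = \int[leb]_y (f y * \int[leb]_x (k (x - y) * psi x)),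
      leb.-integrable setT (EFin \o (fun x => conv f k x * psi x)) &
      leb.-integrable setT (EFin \o (fun y => f y * \int[leb]_x (k (x - y) * psi x)))].
Proof.
move=> mpsi psiN.
have N0 : 0 <= N := le_trans (normr_ge0 _) (psiN 0).
have ikpsi y : leb.-integrable setT (EFin \o (fun x => k (x - y) * psi x)).
  by apply: (integrable_mul_bounded (N := N)) => //; exact: integrable_shift.
have E1 : (fun x => \int[leb]_y (f y * k (x - y) * psi x)) = (fun x => conv f k x * psi x).
  by apply/funext => x; rewrite RintegralZr//; exact: integrable_conv_integrand.
have E2 : (fun y => \int[leb]_x (f y * k (x - y) * psi x)) =
    (fun y => f y * \int[leb]_x (k (x - y) * psi x)).
  apply/funext => y; rewrite -RintegralZl//.
  by apply: eq_Rintegral => x _; rewrite mulrA.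
have := @Rfubini R (fun x y => f y * k (x - y) * psi x)
  (fun y => `|f y| * (N * \int[leb]_x `|k x|)).
rewrite E1 E2; apply.
- apply: measurable_funM.
    apply: measurable_funM; first exact: measurableT_comp.
    by apply: (measurableT_comp mk); apply: measurable_funB.
  exact: measurableT_comp.
- by move=> x; apply: integrable_scale; exact: integrable_conv_integrand.
- move=> y; have := integrable_scale (f y) (ikpsi y).
  by apply: eq_integrable => // x _; rewrite /= mulrC mulrA.
- move=> y.
  have -> : `|f y| * (N * \int[leb]_x `|k x|) = \int[leb]_x (`|k (x - y)| * (`|f y| * N)).
    rewrite RintegralZr//; last first.
      by apply: (integrable_shift (k := fun x => `|k x|)); exact: integrable_norm.
    rewrite (@Rintegral_shift (fun x => `|k x|) y); last exact: integrable_norm.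
    by rewrite mulrA mulrC.
  apply: le_Rintegral => //.
  + apply: integrable_norm; have := integrable_scale (f y) (ikpsi y).
    by apply: eq_integrable => // x _; rewrite /= mulrC mulrA.
  + apply: (integrable_scale (g := fun x => `|k (x - y)|)).
    by apply: integrable_norm; exact: integrable_shift.
  + by move=> x _; rewrite !normrM mulrCA mulrA ler_wpM2l// ?mulr_ge0.
- by apply: (integrable_scale (g := fun x => `|f x|)); exact: integrable_norm.
Qed.

Lemma integrable_conv : leb.-integrable setT (EFin \o conv f k).
Proof.
have [|x|_ + _] := @conv_fubini (cst 1) 1; first by [].
  by rewrite normr1.
by apply: eq_integrable => // x _; rewrite /= mulr1.
Qed.

Lemma Rintegral_conv : \int[leb]_x conv f k x = (\int[leb]_x f x) * \int[leb]_x k x.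
Proof.
have [|x|+ _ _] := @conv_fubini (cst 1) 1; first by [].
  by rewrite normr1.
under eq_Rintegral do rewrite mulr1.
move=> ->; rewrite -RintegralZr//; apply: eq_Rintegral => y _.
by under eq_Rintegral do rewrite mulr1; rewrite Rintegral_shift.
Qed.

Lemma conv_bounded : (forall y, 0 <= f y) -> \int[leb]_x f x = 1 ->
  forall x, `|conv f k x| <= M.
Proof.
move=> f0 f1 x; have ifk := integrable_conv_integrand x.
apply: (le_trans (le_normr_Rintegral _ ifk)) => //.
rewrite -[leRHS]mul1r -f1 -RintegralZr//; apply: le_Rintegral => //.
- exact: integrable_norm.
- exact: integrable_scale.
- by move=> y _; rewrite normrM ger0_norm// ler_wpM2l.
Qed.

End Convolution.

(** * Integrated square error averaged over an i.i.d. sample *)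

Section MISE.
Variable R : realType.
Local Notation leb := (@lebesgue_measure R).

Lemma integrable_density (f : R -> R) : is_density f ->
  leb.-integrable setT (EFin \o f).
Proof. by move=> [mf f0 f1]; apply: integrable_ge0P => //; rewrite f1 ltry. Qed.

Lemma Rintegral_density (f : R -> R) : is_density f -> \int[leb]_x f x = 1.
Proof. by move=> [_ _ f1]; rewrite /Rintegral f1. Qed.

Lemma integrable_sqr (k : R -> R) (M : R) : leb.-integrable setT (EFin \o k) ->
  (forall x, `|k x| <= M) -> leb.-integrable setT (EFin \o (fun x => k x ^+ 2)).
Proof.
move=> ik kM; have := integrable_mul_bounded ik (integrable_measurable ik) kM.
by apply: eq_integrable => // x _; rewrite /= expr2.
Qed.

Lemma sqr_bounded (k : R -> R) (M : R) : (forall x, `|k x| <= M) ->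
  forall x, `|k x ^+ 2| <= M ^+ 2.
Proof.
move=> kM x; rewrite normrX lerXn2r// nnegrE//.
exact: le_trans (kM x).
Qed.

Variables (f k : R -> R) (M : R).
Hypotheses (df : is_density f) (intk : leb.-integrable setT (EFin \o k))
  (kM : forall x, `|k x| <= M).

Let mf : measurable_fun setT f := let: And3 h _ _ := df in h.
Let f0 x : 0 <= f x := (let: And3 _ h _ := df in h) x.
Let intf : leb.-integrable setT (EFin \o f) := integrable_density df.
Let intk2 := integrable_sqr intk kM.
Let mk : measurable_fun setT k := integrable_measurable intk.

Local Notation G := (conv f k).
Local Notation V := (conv f (fun z => k z ^+ 2)).

Lemma integrable_affine_sqr (a c d x : R) :
  leb.-integrable setT (EFin \o (fun y => f y * ((a + c * k (x - y)) ^+ 2 + d))).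
Proof.
have i1 := integrable_scale (a ^+ 2 + d) intf.
have i2 := integrable_scale (2 * a * c) (integrable_conv_integrand intf intk kM x).
have i3 := integrable_scale (c ^+ 2) (integrable_conv_integrand intf intk2 (sqr_bounded kM) x).
have := integrable_add (integrable_add i1 i2) i3.
by apply: eq_integrable => // y _; rewrite /=; congr EFin; ring.
Qed.

(** If [Y] has density [f], then [G x] and [V x] are the first two moments of [k (x - Y)]. The
    constants are left free so that one expansion serves for the variance, for the induction over
    the sample and for the equality case of Young's inequality. *)
Lemma Rintegral_affine_sqr (a c d x : R) :
  \int[leb]_y (f y * ((a + c * k (x - y)) ^+ 2 + d)) =
  a ^+ 2 + 2 * a * c * G x + c ^+ 2 * V x + d.
Proof.
have i2' := integrable_conv_integrand intf intk kM x.
have i3' := integrable_conv_integrand intf intk2 (sqr_bounded kM) x.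
have i1 := integrable_scale (a ^+ 2 + d) intf.
have i2 := integrable_scale (2 * a * c) i2'.
have i3 := integrable_scale (c ^+ 2) i3'.
transitivity (\int[leb]_y (f y * (a ^+ 2 + d) + f y * k (x - y) * (2 * a * c) +
    f y * k (x - y) ^+ 2 * c ^+ 2)).
  by apply: eq_Rintegral => y _; ring.
rewrite RintegralD//; last exact: integrable_add.
rewrite RintegralD// !RintegralZr// Rintegral_density// /conv; ring.
Qed.

(** The difference of the two sides is the variance of [k (x - Y)] for [Y] of density [f]. *)
Lemma conv_sqr_le x : G x ^+ 2 <= V x.
Proof.
have := Rintegral_affine_sqr (- G x) 1 0 x.
have : 0 <= \int[leb]_y (f y * ((- G x + 1 * k (x - y)) ^+ 2 + 0)).
  by apply: Rintegral_ge0 => y _; rewrite addr0 mulr_ge0// sqr_ge0.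
move=> + E; rewrite E; lra.
Qed.

(** The arbitrary offset [A] makes the induction work: once the first observation is fixed, its term
    [c * k (x - X)] joins the offset. Averaging over that observation then adds [c * G x] to the
    mean and [c ^+ 2 * (V x - G x ^+ 2)] to the variance. *)
Lemma iid_expect_ise (n : nat) (c : R) (A : R -> R) : measurable_fun setT A ->
  (iid_expect f n (fun s =>
    \int[leb]_x ((A x + c * \sum_(X <- s) k (x - X)) ^+ 2)%R%:E) =
  \int[leb]_x ((A x + n%:R * c * G x) ^+ 2 +
    n%:R * c ^+ 2 * (V x - G x ^+ 2))%R%:E)%E.
Proof.
have mG : measurable_fun setT G by exact: (integrable_measurable (integrable_conv intf intk kM)).
have mV : measurable_fun setT V.
  exact: (integrable_measurable (integrable_conv intf intk2 (sqr_bounded kM))).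
elim: n A => [|n IH] A mA /=.
  by apply: eq_integral => x _; rewrite big_nil; congr EFin; ring.
pose H X x := (A x + c * k (x - X) + n%:R * c * G x) ^+ 2 +
    n%:R * c ^+ 2 * (V x - G x ^+ 2).
have D0 x : 0 <= n%:R * c ^+ 2 * (V x - G x ^+ 2).
  by apply: mulr_ge0; [apply: mulr_ge0 => //; exact: sqr_ge0|rewrite subr_ge0 conv_sqr_le].
have H0 X x : 0 <= f X * H X x.
  by rewrite mulr_ge0// addr_ge0 ?sqr_ge0.
have mH : measurable_fun setT (fun z : R * R => f z.1 * H z.1 z.2).
  apply: measurable_funM; first exact: measurableT_comp.
  apply: measurable_funD; last first.
    apply: measurable_funM => //; apply: measurable_funB; first exact: measurableT_comp.
    by apply: measurable_funX; exact: measurableT_comp.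
  apply: measurable_funX; apply: measurable_funD; last first.
    by apply: measurable_funM => //; exact: measurableT_comp.
  apply: measurable_funD; first exact: measurableT_comp.
  apply: measurable_funM => //; apply: (measurableT_comp mk).
  exact: measurable_funB.
transitivity (\int[leb]_X \int[leb]_x (f X * H X x)%:E)%E.
  apply: eq_integral => X _.
  under eq_fun do under eq_integral do rewrite big_cons mulrDr addrA.
  rewrite (IH (fun x => A x + c * k (x - X))); last first.
    apply: measurable_funD => //; apply: measurable_funM => //.
    by apply: (measurableT_comp mk); apply: measurable_funB.
  under [RHS]eq_integral do rewrite EFinM.
  rewrite ge0_integralZl_EFin//.
  - by move=> x _; rewrite lee_fin addr_ge0 ?sqr_ge0.
  - apply/measurable_EFinP; apply: measurable_funD.
      apply: measurable_funX; apply: measurable_funD; last exact: measurable_funM.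
      apply: measurable_funD => //; apply: measurable_funM => //.
      by apply: (measurableT_comp mk); apply: measurable_funB.
    apply: measurable_funM => //; apply: measurable_funB => //.
    exact: measurable_funX.
(* Exchanging the integrals leaves, for each fixed [x], a mean over the first observation, which
   [Rintegral_affine_sqr] evaluates. *)
have /= -> := fubini_tonelli (m1 := leb) (m2 := leb) (fun z : R * R => (f z.1 * H z.1 z.2)%:E); last first.
- by move=> z; rewrite lee_fin.
- exact/measurable_EFinP.
apply: eq_integral => x _.
pose d := n%:R * c ^+ 2 * (V x - G x ^+ 2).
pose a := A x + n%:R * c * G x.
transitivity (\int[leb]_X (f X * ((a + c * k (x - X)) ^+ 2 + d)))%:E.
  rewrite EFin_Rintegral; last exact: integrable_affine_sqr.
  by apply: eq_integral => X _; rewrite /H /a /d; congr EFin; ring.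
by rewrite Rintegral_affine_sqr /a /d -natr1; congr EFin; ring.
Qed.

End MISE.

(** * Products and differences of square integrable functions *)

Section SquareIntegrable.
Variable R : realType.
Local Notation leb := (@lebesgue_measure R).
Local Notation sq_integrable g :=
  (leb.-integrable setT (EFin \o (fun x : R => g x ^+ 2))).
Implicit Types f g : R -> R.

Lemma L2_integrable f : L2 f -> sq_integrable f.
Proof.
move=> [mf f2]; apply: integrable_ge0P => //; first exact: measurable_funX.
by move=> x; exact: sqr_ge0.
Qed.

Lemma integrable_mul_L2 f g : measurable_fun setT f -> measurable_fun setT g ->
  sq_integrable f -> sq_integrable g ->
  leb.-integrable setT (EFin \o (fun x => f x * g x)).
Proof.
move=> mf mg f2 g2; apply: integrable_le (integrable_add f2 g2).
  exact: measurable_funM.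
move=> x; rewrite ler_norml; have := sqr_ge0 (f x - g x); have := sqr_ge0 (f x + g x).
by have := sqr_ge0 (f x); have := sqr_ge0 (g x); nra.
Qed.

Lemma integrable_sqr_sub f g : measurable_fun setT f -> measurable_fun setT g ->
  sq_integrable f -> sq_integrable g -> sq_integrable (fun x => f x - g x).
Proof.
move=> mf mg f2 g2; have fg := integrable_mul_L2 mf mg f2 g2.
have := integrable_add (integrable_sub f2 (integrable_scale 2 fg)) g2.
by apply: eq_integrable => // x _; rewrite /=; congr EFin; ring.
Qed.

Lemma Rintegral_sqr_sub f g : measurable_fun setT f -> measurable_fun setT g ->
  sq_integrable f -> sq_integrable g ->
  \int[leb]_x (f x - g x) ^+ 2 = \int[leb]_x f x ^+ 2 -
    2 * (\int[leb]_x (f x * g x)) + \int[leb]_x g x ^+ 2.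
Proof.
move=> mf mg f2 g2; have fg := integrable_mul_L2 mf mg f2 g2.
have fg2 := integrable_scale 2 fg.
rewrite [2 * _]mulrC -RintegralZr// -RintegralB// -RintegralD//; last exact: integrable_sub.
by apply: eq_Rintegral => x _; ring.
Qed.

End SquareIntegrable.

(** * Bias and variance of the risk, and a lower bound uniform in the kernel *)

Section RiskDecomposition.
Variable R : realType.
Local Notation leb := (@lebesgue_measure R).
Variables (f k : R -> R) (M : R).
Hypotheses (df : is_density f) (f2 : leb.-integrable setT (EFin \o (fun x => f x ^+ 2)))
  (intk : leb.-integrable setT (EFin \o k)) (kM : forall x, `|k x| <= M).

Let mf : measurable_fun setT f := let: And3 h _ _ := df in h.
Let f0 x : 0 <= f x := (let: And3 _ h _ := df in h) x.
Let intf : leb.-integrable setT (EFin \o f) := integrable_density df.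
Let f1 : \int[leb]_x f x = 1 := Rintegral_density df.
Let intk2 := integrable_sqr intk kM.
Let mk : measurable_fun setT k := integrable_measurable intk.

Local Notation G := (conv f k).
Local Notation V := (conv f (fun z => k z ^+ 2)).

Let mG : measurable_fun setT G := integrable_measurable (integrable_conv intf intk kM).
Let intV := integrable_conv intf intk2 (sqr_bounded kM).

Lemma integrable_conv_sqr : leb.-integrable setT (EFin \o (fun x => G x ^+ 2)).
Proof.
apply: integrable_le intV; first exact: measurable_funX.
by move=> x; rewrite ger0_norm ?sqr_ge0// (conv_sqr_le df intk kM).
Qed.

Lemma Rintegral_conv_var :
  \int[leb]_x (V x - G x ^+ 2) = \int[leb]_x k x ^+ 2 - \int[leb]_x G x ^+ 2.
Proof.
rewrite RintegralB//; last exact: integrable_conv_sqr.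
by rewrite (Rintegral_conv intf intk2 (sqr_bounded kM)) f1 mul1r.
Qed.

(** Young's inequality for a density, read as nonnegativity of an integrated variance; in this form
    the equality case can be examined point by point. *)
Lemma conv_norm_le : \int[leb]_x G x ^+ 2 <= \int[leb]_x k x ^+ 2.
Proof.
rewrite -subr_ge0 -Rintegral_conv_var; apply: Rintegral_ge0 => x _.
by rewrite subr_ge0 (conv_sqr_le df intk kM).
Qed.

(** Only samples of length [n] are ever evaluated, so the factor [(size s)%:R^-1] of the estimator
    may be replaced by the constant [n%:R^-1]. *)
Lemma iid_expect_ext n (g1 g2 : seq R -> \bar R) :
  (forall s, size s = n -> g1 s = g2 s) -> iid_expect f n g1 = iid_expect f n g2.
Proof.
elim: n g1 g2 => [|n IH] g1 g2 E /=; first exact: E.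
by apply: eq_integral => x _; congr (_ * _)%E; apply: IH => s sn; rewrite E//= sn.
Qed.

Lemma iid_expect_risk n : (0 < n)%N ->
  iid_expect f n (fun s => \int[leb]_x
    (((size s)%:R^-1 * \sum_(X <- s) k (x - X) - f x) ^+ 2)%:E)%E =
  (\int[leb]_x (G x - f x) ^+ 2 +
    n%:R^-1 * (\int[leb]_x k x ^+ 2 - \int[leb]_x G x ^+ 2))%:E.
Proof.
move=> n0; have n0' : n%:R != 0 :> R by rewrite pnatr_eq0 -lt0n.
have iV : leb.-integrable setT (EFin \o (fun x => V x - G x ^+ 2)).
  by apply: integrable_sub => //; exact: integrable_conv_sqr.
have iB := integrable_sqr_sub mG mf integrable_conv_sqr f2.
rewrite -Rintegral_conv_var mulrC -RintegralZr// -RintegralD//; last exact: integrable_scale.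
(* This is the form of [iid_expect_ise] with offset [- f] and [c = 1 / n]; the variance term
   [n * c ^ 2] becomes [1 / n]. *)
transitivity (iid_expect f n (fun s => \int[leb]_x
    ((- f x + n%:R^-1 * \sum_(X <- s) k (x - X)) ^+ 2)%:E)%E).
  by apply: iid_expect_ext => s ->; apply: eq_integral => x _; rewrite addrC.
rewrite (iid_expect_ise df intk kM); last exact: measurableT_comp.
rewrite EFin_Rintegral; last by apply: integrable_add => //; exact: integrable_scale.
by apply: eq_integral => x _; congr EFin; field.
Qed.

(* The Fourier-side inequality [|1-z|^2 A + |z|^2 (1-A)/n >= A (1-A)/n] amounts
   here to completing the square: [f * f] is the best filter, and
   [||k - f * f||^2 >= 0] gives the bound for any other [k]. *)
Lemma risk_ge n (Mf : R) : (0 < n)%N -> (forall x, f x <= Mf) -> (forall x, f (- x) = f x) ->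
  n%:R^-1 * (\int[leb]_x f x ^+ 2 - \int[leb]_x conv f f x ^+ 2) <=
  \int[leb]_x (G x - f x) ^+ 2 +
    n%:R^-1 * (\int[leb]_x k x ^+ 2 - \int[leb]_x G x ^+ 2).
Proof.
move=> n0 fMf fev; have n0' : 0 < n%:R :> R by rewrite ltr0n.
have fMf' x : `|f x| <= Mf by rewrite ger0_norm.
set q := conv f f.
have iq := integrable_conv intf intf fMf'.
have mq : measurable_fun setT q := integrable_measurable iq.
have q2 : leb.-integrable setT (EFin \o (fun x => q x ^+ 2)).
  by apply: (integrable_sqr (M := Mf)) => //; exact: conv_bounded.
(* Convolution with the even function [f] is self-adjoint, so one factor [f] passes from [f * f] to
   [k]. *)
have kq : \int[leb]_x (k x * q x) = \int[leb]_x (G x * f x).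
  have [E _ _] := conv_fubini intf intf fMf' mk kM.
  under eq_Rintegral do rewrite mulrC; rewrite E; apply: eq_Rintegral => y _.
  rewrite mulrC; congr (_ * _); rewrite convC; last exact: integrable_conv_integrand.
  by apply: eq_Rintegral => x _; rewrite mulrC -[in RHS]fev opprB.
have h1 : 0 <= \int[leb]_x (k x - q x) ^+ 2.
  by apply: Rintegral_ge0 => x _; exact: sqr_ge0.
have h2 : 0 <= \int[leb]_x (G x - f x) ^+ 2.
  by apply: Rintegral_ge0 => x _; exact: sqr_ge0.
rewrite Rintegral_sqr_sub// kq in h1.
have n1 : 1 <= n%:R :> R by rewrite ler1n.
rewrite -(ler_pM2l n0') [leRHS]mulrDr !mulVKf ?gt_eqF//.
(* After multiplication by [n] the bias has weight at least 1. With weight exactly 1 the terms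
   [||G||^2] cancel and [||k - f * f||^2 + ||f||^2 - ||f * f||^2] remains. *)
have : \int[leb]_x (G x - f x) ^+ 2 <= n%:R * \int[leb]_x (G x - f x) ^+ 2.
  by rewrite ler_peMl.
rewrite {1}Rintegral_sqr_sub//; last exact: integrable_conv_sqr.
by move: h1; rewrite -/q; lra.
Qed.

End RiskDecomposition.

(** * Almost-everywhere statements under affine maps and vanishing integrals *)

Section AlmostEverywhere.
Variable R : realType.
Local Notation leb := (@lebesgue_measure R).

Lemma ae_filterS2 (P Q S : R -> Prop) : (forall x, P x -> Q x -> S x) ->
  {ae leb, forall x, P x} -> {ae leb, forall x, Q x} -> {ae leb, forall x, S x}.
Proof.
move=> PQS hP hQ.
have FF : Filter (almost_everywhere leb) by exact: ae_filter_ringOfSetsType.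
exact: filterS2 PQS hP hQ.
Qed.

Lemma ae_filterS (P Q : R -> Prop) : (forall x, P x -> Q x) ->
  {ae leb, forall x, P x} -> {ae leb, forall x, Q x}.
Proof. by move=> PQ hP; apply: (ae_filterS2 _ hP hP) => x Px _; exact: PQ. Qed.

Lemma ae_affine (P : R -> Prop) (a b : R) : a != 0 -> {ae leb, forall x, P x} ->
  {ae leb, forall x, P (a * x + b)}.
Proof.
move=> a0 [A [mA A0 PA]].
exists ((fun x : R => a * x + b) @^-1` A); split.
- by rewrite -[X in measurable X]setTI; exact: measurable_affine.
- have := lebesgue_measure_affine b a0 mA; rewrite [X in X = _]A0 => /esym/eqP.
  by rewrite mule_eq0 eqe normr_eq0 (negPf a0) => /eqP.
- by move=> x /= nP; apply: PA.
Qed.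

Lemma lebesgue_measure_setT : leb setT = +oo%E.
Proof. by rewrite -set_itvNyy lebesgue_measure_itv. Qed.

Lemma ae_exists (P : R -> Prop) : {ae leb, forall x, P x} -> exists x, P x.
Proof.
move=> [A [mA A0 PA]]; apply: contrapT => /forallNP nP.
have AT : A = setT by apply/seteqP; split => // x _; exact: PA (nP x).
by move: A0; rewrite AT lebesgue_measure_setT.
Qed.

Lemma Rintegral_eq0_ae (g : R -> R) : leb.-integrable setT (EFin \o g) ->
  (forall x, 0 <= g x) -> \int[leb]_x g x = 0 -> {ae leb, forall x, g x = 0}.
Proof.
move=> ig g0 E.
have : (\int[leb]_x `|(EFin \o g) x| = 0)%E.
  under eq_integral do rewrite /= ger0_norm//.
  by rewrite -EFin_Rintegral// E.
move/(ae_eq_integral_abs leb measurableT (measurable_int _ ig)).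
by apply: filterS => x /(_ I)[].
Qed.

End AlmostEverywhere.

(** * Strictness in Young's inequality *)

Section StrictYoung.
Variable R : realType.
Local Notation leb := (@lebesgue_measure R).
Variables (f : R -> R) (M : R).
Hypotheses (df : is_density f) (fM : forall x, f x <= M)
  (fpos : {ae leb, forall x, 0 < f x}).

(** Equality would make the variance of [f (x - Y)] vanish for almost every [x]. Fixing one such
    [x], [f (x - y)] is constant for almost every [y], since the weight [f y] is positive; but a
    constant has integral 0 or infinite over the line, never 1. *)
Lemma conv_self_norm_lt :
  \int[leb]_x conv f f x ^+ 2 < \int[leb]_x f x ^+ 2.
Proof.
have [mf f0 _] := df.
have intf := integrable_density df.
have fM' x : `|f x| <= M by rewrite ger0_norm.
have f2 := integrable_sqr intf fM'.
rewrite lt_neqAle (conv_norm_le df intf fM') andbT; apply/eqP => E.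
have := Rintegral_conv_var df intf fM'.
rewrite E subrr => /Rintegral_eq0_ae H.
have {H} [] := ae_exists (H _ _).
- apply: integrable_sub; last exact: (integrable_conv_sqr df intf fM').
  exact: (integrable_conv intf f2 (sqr_bounded fM')).
- by move=> x; rewrite subr_ge0 (conv_sqr_le df intf fM').
move=> x Dx0.
pose c := conv f f x.
(* The centred second moment of [f (x - Y)] about its mean [c], zero by the choice of [x]. *)
have := Rintegral_affine_sqr df intf fM' (- c) 1 0 x.
rewrite (_ : _ + 0 = 0); last by move: Dx0; rewrite -/c; lra.
move=> /Rintegral_eq0_ae H.
have {H} H := H (integrable_affine_sqr df intf fM' _ _ _ _) _.
have {H} : {ae leb, forall y, f y * ((- c + 1 * f (x - y)) ^+ 2 + 0) = 0}.
  by apply: H => y; rewrite addr0 mulr_ge0// sqr_ge0.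
move=> H.
have {H} H : {ae leb, forall y, f (x - y) = c}.
  apply: ae_filterS2 H fpos => y /eqP; rewrite mulf_eq0 addr0 sqrf_eq0 => + fy.
  by rewrite (gt_eqF fy)/= mul1r addrC subr_eq0 => /eqP.
have H' : {ae leb, forall y, f y = c}.
  have a0 : -1 != 0 :> R by rewrite oppr_eq0 oner_eq0.
  apply: ae_filterS (ae_affine x a0 H) => y <-.
  by rewrite mulN1r; congr f; ring.
have : (\int[leb]_y (f y)%:E = \int[leb]_y (cst c%:E) y)%E.
  apply: ae_eq_integral => //; first exact/measurable_EFinP.
  by apply: (@ae_filterS _ _ (fun y => setT y -> (f y)%:E = c%:E) _ H') => y ->.
have [_ _ ->] := df; rewrite integral_cst//.
rewrite [X in (_ * X)%E]lebesgue_measure_setT mulr_infty.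
by case: sgrP => _; rewrite ?mul0e ?mul1e ?mulN1e// => -[] /eqP; rewrite oner_eq0.
Qed.

End StrictYoung.

(** * The zeros of the sine form a null set *)

Section SineZeros.
Variable R : realType.
Local Notation leb := (@lebesgue_measure R).

Lemma sin_intpi (z : int) : sin (z%:~R * pi) = 0 :> R.
Proof.
have sinn (n : nat) : sin (n%:R * pi) = 0 :> R.
  have := alternatingn (@sinDpi R) n 0.
  by rewrite add0r mulr_natl sin0 mulr0.
by case: z => n; rewrite ?NegzE ?mulrNz ?mulNr ?sinN sinn ?oppr0.
Qed.

Lemma sin_eq0_intpi (x : R) : sin x = 0 -> exists z : int, x = z%:~R * pi.
Proof.
move=> sx; exists (Num.floor (x / pi)).
have pi0 := @pi_gt0 R.
set z := Num.floor _; pose y := x - z%:~R * pi.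
have /andP[] := floor_itv (x / pi); rewrite -/z intrD mulr1z.
rewrite ler_pdivlMr// ltr_pdivrMr// => y0 y1.
have sy : sin y = 0 by rewrite sinB sx sin_intpi mul0r mulr0 subr0.
apply/eqP; rewrite -subr_eq0 -/y; apply: contraT => yn0.
have : 0 < sin y.
  apply: sin_gt0_pi; rewrite lt_def yn0 /y /= subr_ge0 y0/=.
  by move: y1; rewrite mulrDl mul1r ltrBlDr addrC.
by rewrite sy ltxx.
Qed.

(** Serves twice: off this set [1 - cos x > 0], so the Fejer function is positive, and
    [|cos x| < 1], so powers of the cosine tend to 0. *)
Lemma ae_sin_neq0 : {ae leb, forall x : R, sin x != 0}.
Proof.
pose A := range (fun z : int => z%:~R * pi : R).
have cA : countable A by apply: sub_countable (card_image_le _ _) _; exact: countableP.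
exists A; split.
- by apply: countable_measurable => // t; exact: measurable_set1.
- exact: countable_lebesgue_measure0.
- by move=> x /negP; rewrite negbK => /eqP/sin_eq0_intpi[z ->]; exists z.
Qed.

End SineZeros.

(** * Rescaled kernels: norms, pairings and characteristic functions *)

Section Dilation.
Variable R : realType.
Local Notation leb := (@lebesgue_measure R).
Variables (K : R -> R) (h M : R).
Hypotheses (intK : leb.-integrable setT (EFin \o K)) (h0 : 0 < h)
  (KM : forall x, `|K x| <= M).

Let hn0 : h != 0 := lt0r_neq0 h0.

Lemma integrable_Kh : leb.-integrable setT (EFin \o Kh K h).
Proof.
have hV0 : h^-1 != 0 by rewrite invr_eq0.
have := integrable_scale h^-1 (integrable_affine 0 hV0 intK).
by apply: eq_integrable => // x _; rewrite /Kh/= addr0 mulrC [h^-1 * x]mulrC mulrC.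
Qed.

Lemma Kh_bounded x : `|Kh K h x| <= M / h.
Proof. by rewrite /Kh normrM (gtr0_norm (x := h^-1)) ?invr_gt0// ler_pM2r ?invr_gt0. Qed.

Lemma Rintegral_Kh_sqr : \int[leb]_x Kh K h x ^+ 2 = (\int[leb]_x K x ^+ 2) / h.
Proof.
have iKh := integrable_sqr integrable_Kh Kh_bounded.
have iK2 := integrable_sqr intK KM.
rewrite -(Rintegral_affine 0 hn0 iKh) gtr0_norm// -!RintegralZr//.
rewrite mulrC -RintegralZr//; last exact: (integrable_affine 0 hn0 iKh).
by apply: eq_Rintegral => x _; rewrite /Kh addr0 [h * x]mulrC mulfK//; field.
Qed.

Lemma Rintegral_Kh_mul (psi : R -> R) (N y : R) : measurable_fun setT psi ->
  (forall x, `|psi x| <= N) ->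
  \int[leb]_x (Kh K h (x - y) * psi x) = \int[leb]_u (K u * psi (y + h * u)).
Proof.
move=> mpsi psiN.
have ig : leb.-integrable setT (EFin \o (fun x => Kh K h (x - y) * psi x)).
  by apply: (integrable_mul_bounded (N := N)) => //; exact/integrable_shift/integrable_Kh.
rewrite -(Rintegral_affine y hn0 ig) gtr0_norm// mulrC -RintegralZr//; last first.
  exact: (integrable_affine y hn0 ig).
by apply: eq_Rintegral => x _; rewrite /Kh addrK [h * x]mulrC mulfK// [_ + y]addrC; field.
Qed.

Lemma measurable_cosM (t : R) : measurable_fun setT (fun x : R => cos (t * x)).
Proof. by apply: measurableT_comp => //; exact: continuous_measurable_fun (@continuous_cos R). Qed.

Lemma measurable_sinM (t : R) : measurable_fun setT (fun x : R => sin (t * x)).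
Proof. by apply: measurableT_comp => //; exact: continuous_measurable_fun (@continuous_sin R). Qed.

Lemma charRe_Kh t : charRe (Kh K h) t = charRe K (t * h).
Proof.
have := Rintegral_Kh_mul 0 (measurable_cosM t) (fun x => cos_max _).
rewrite /charRe; under eq_Rintegral do rewrite subr0 mulrC; move=> ->.
by apply: eq_Rintegral => x _; rewrite add0r mulrA mulrC.
Qed.

Lemma charIm_Kh t : charIm (Kh K h) t = charIm K (t * h).
Proof.
have := Rintegral_Kh_mul 0 (measurable_sinM t) (fun x => sin_max _).
rewrite /charIm; under eq_Rintegral do rewrite subr0 mulrC; move=> ->.
by apply: eq_Rintegral => x _; rewrite add0r mulrA mulrC.
Qed.

End Dilation.

(** * The Fejer function as a cosine transform *)

Section Fejer.
Variable R : realType.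
Local Notation leb := (@lebesgue_measure R).

(** The right half of the triangle function: the cosine being even, the left half would only double
    [fejer]. *)
Definition tent (t : R) : R := if 0 <= t <= 1 then 1 - t else 0.

(** This is [(1 - cos x) / x ^ 2], with its limit [1 / 2] at the origin. The integral form needs no
    separate case at 0 and displays the bounded spectrum used in [conv_fejer]. *)
Definition fejer (x : R) : R := \int[leb]_t (tent t * cos (t * x)).

Lemma tentE : tent = (fun t : R => 1 - t) \_ `[0, 1]%classic.
Proof. by apply/funext => t; rewrite patchE mem_setE in_itv. Qed.

Lemma tent_ge0 (t : R) : 0 <= tent t.
Proof. by rewrite /tent; case: ifPn => // /andP[_]; rewrite subr_ge0. Qed.

Lemma continuous_1B : continuous (fun t : R => 1 - t).
Proof. by move=> t; apply: cvgB; [exact: cvg_cst|exact: cvg_id]. Qed.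

Lemma integrable_tent : leb.-integrable setT (EFin \o tent).
Proof.
have := @continuous_compact_integrable R (fun t => 1 - t) `[0, 1] (@segment_compact _ _ _)
  (continuous_subspaceT continuous_1B).
move=> H; have mI : measurable (`[0, 1]%classic : set (measurableTypeR R)) by exact: measurable_itv.
have := (@integrable_mkcond _ _ _ leb _ (EFin \o (fun t : R => 1 - t)) mI).1 H.
apply: eq_integrable => // t _ /=; by rewrite tentE !patchE; case: ifP.
Qed.

Lemma integrable_tent_cos (x : R) :
  leb.-integrable setT (EFin \o (fun t => tent t * cos (t * x))).
Proof.
apply: (integrable_mul_bounded (N := 1)) integrable_tent _ _ => [|t]; last exact: cos_max.
by under eq_fun do rewrite mulrC; exact: measurable_cosM.
Qed.

Lemma fejer_even x : fejer (- x) = fejer x.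
Proof. by apply: eq_Rintegral => t _; rewrite mulrN cosN. Qed.

Lemma fejer_le0 x : fejer x <= fejer 0.
Proof.
apply: le_Rintegral => //; [exact: integrable_tent_cos|exact: integrable_tent_cos|].
by move=> t _; rewrite mulr0 cos0 ler_wpM2l ?tent_ge0 ?cos_le1.
Qed.

Lemma fejer_sqr x : fejer x * x ^+ 2 = 1 - cos x.
Proof.
have [->|x0] := eqVneq x 0; first by rewrite cos0 subrr expr0n mulr0.
(* Antiderivative of [(1 - t) * cos (t * x)], found by one integration by parts. *)
pose F (t : R) : R := (1 - t) * sin (t * x) / x - cos (t * x) / x ^+ 2.
have dF (t : R) : is_derive t 1 F ((1 - t) * cos (t * x)).
  have d1 : is_derive t 1 (fun t : R => t * x) x.
    apply: (is_derive_eq (@is_deriveM _ _ _ _ t 1 _ _ (is_derive_id t 1) (is_derive_cst x t 1))).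
    by rewrite /GRing.scale/= mulr0 add0r mulr1.
  have ds : is_derive t 1 (fun t : R => sin (t * x)) (cos (t * x) * x).
    exact: (@is_derive1_comp _ sin (fun t => t * x)).
  have dc : is_derive t 1 (fun t : R => cos (t * x)) (- sin (t * x) * x).
    exact: (@is_derive1_comp _ cos (fun t => t * x)).
  have d1t : is_derive t 1 (fun t : R => 1 - t) (- 1).
    apply: (is_derive_eq (@is_deriveB _ _ _ _ _ t 1 _ _ (is_derive_cst (1 : R) t 1) (is_derive_id t 1))).
    by rewrite sub0r.
  have dm := @is_deriveM _ _ _ _ t 1 _ _ d1t ds.
  have dm' := @is_deriveM _ _ _ _ t 1 _ _ dm (is_derive_cst x^-1 t 1).
  have dc' := @is_deriveM _ _ _ _ t 1 _ _ dc (is_derive_cst (x ^+ 2)^-1 t 1).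
  apply: (is_derive_eq (@is_deriveB _ _ _ _ _ t 1 _ _ dm' dc')).
  by rewrite /GRing.scale/=; field.
have cF : continuous F.
  by move=> t; apply: differentiable_continuous; apply/derivable1_diffP; exact: ex_derive.
have E : (\int[leb]_(t in `[0%R, 1%R]) ((1 - t) * cos (t * x))%:E = (F 1)%:E - (F 0)%:E)%E.
  apply: continuous_FTC2 => //.
  - apply: continuous_subspaceT => t; apply: cvgM; first exact: continuous_1B.
    apply: continuous_comp; last exact: continuous_cos.
    exact: mulrr_continuous.
  - split; [by move=> t _; exact: ex_derive|
      apply: cvg_at_right_filter; exact: cF|apply: cvg_at_left_filter; exact: cF].
  - by move=> t _; rewrite derive1E; exact: derive_val.
have -> : fejer x = F 1 - F 0.
  rewrite -[RHS]/(fine ((F 1)%:E - (F 0)%:E)%E) -E /fejer /Rintegral; congr fine.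
  rewrite [RHS]integral_mkcond; apply: eq_integral => t _.
  by rewrite tentE !patchE; case: ifP => _; rewrite ?mul0r.
rewrite /F subrr !mul0r mul1r subr0 sin0 cos0; field.
exact: x0.
Qed.

Lemma fejer_ge0 x : 0 <= fejer x.
Proof.
have [->|x0] := eqVneq x 0.
  by apply: Rintegral_ge0 => t _; rewrite mulr0 cos0 mulr1 tent_ge0.
have x2 : 0 < x ^+ 2 by rewrite exprn_even_gt0.
by rewrite -(pmulr_lge0 _ x2) fejer_sqr subr_ge0 cos_le1.
Qed.

Lemma fejer_gt0 x : sin x != 0 -> 0 < fejer x.
Proof.
move=> sx; rewrite lt_def fejer_ge0 andbT; apply: contraNneq sx => fx0.
have := fejer_sqr x; rewrite fx0 mul0r => /eqP; rewrite eq_sym subr_eq0 => /eqP cx.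
by rewrite -sqrf_eq0 sin2cos2 -cx expr1n subrr.
Qed.

(** Multiply by [1 + x ^ 2]: the term [fejer x] is at most [fejer 0], and
    [fejer x * x ^ 2 = 1 - cos x] is at most 2. *)
Lemma fejer_le x : fejer x <= (fejer 0 + 2) * (oneDsqr x)^-1.
Proof.
have x1 : 0 < oneDsqr x by rewrite (lt_le_trans _ (oneDsqr_ge1 x)).
rewrite ler_pdivlMr// /oneDsqr mulrDr mulr1 fejer_sqr lerD ?fejer_le0//.
by rewrite lerBlDr -lerBlDl (le_trans _ (cos_geN1 x))//; lra.
Qed.

Lemma integrable_oneDsqrV : leb.-integrable setT (EFin \o (fun x : R => (oneDsqr x)^-1)).
Proof.
apply: integrable_ge0P.
- exact: continuous_measurable_fun (@continuous_oneDsqrV R).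
- by move=> x; rewrite invr_ge0 (le_trans _ (oneDsqr_ge1 x)).
- rewrite ge0_symfun_integralT.
  + by rewrite -set_itvcy integral0y_oneDsqr -EFinM ltry.
  + by move=> x; rewrite invr_ge0 (le_trans _ (oneDsqr_ge1 x)).
  + exact: (@continuous_oneDsqrV R).
  + by move=> x; rewrite /= /oneDsqr sqrrN.
Qed.

(** The issue is measurability. The integrand [tent t * cos (t * x)] is not integrable in the plane,
    so it is first weighted by [(oneDsqr x)^-1], and the weight is divided out after Fubini.
    Domination by [fejer_le] then gives integrability. *)
Lemma integrable_fejer : leb.-integrable setT (EFin \o fejer).
Proof.
have iO := integrable_oneDsqrV.
have mO : measurable_fun setT (fun x : R => (oneDsqr x)^-1) := integrable_measurable iO.
have mc : measurable_fun setT (fun z : R * R => cos (z.2 * z.1)).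
  apply: (measurableT_comp (continuous_measurable_fun (@continuous_cos R))).
  exact: measurable_funM.
have O1 (x : R) : `|(oneDsqr x)^-1| <= 1.
  by rewrite ger0_norm ?oneDsqrV_le1// invr_ge0 (le_trans _ (oneDsqr_ge1 x)).
have mt : measurable_fun setT tent := integrable_measurable integrable_tent.
have [] := @Rfubini R (fun x t => (tent t * cos (t * x)) * (oneDsqr x)^-1)
   (fun t => `|tent t| * \int[leb]_x (oneDsqr x)^-1).
- apply: measurable_funM; last exact: (measurableT_comp mO).
  by apply: measurable_funM => //; exact: (measurableT_comp mt).
- by move=> x; apply: integrable_scale; exact: integrable_tent_cos.
- move=> t; have := integrable_scale (tent t)
    (integrable_mul_bounded iO (measurable_cosM t) (fun x => cos_max (t * x))).
  by apply: eq_integrable => // x _; rewrite /=; congr EFin; ring.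
- move=> t; rewrite mulrC -RintegralZr//; apply: le_Rintegral => //.
  + apply: integrable_norm; have := integrable_scale (tent t)
      (integrable_mul_bounded iO (measurable_cosM t) (fun x => cos_max (t * x))).
    by apply: eq_integrable => // x _; rewrite /=; congr EFin; ring.
  + exact: integrable_scale.
  + move=> x _; rewrite !normrM mulrC [`|_^-1|]ger0_norm; last first.
      by rewrite invr_ge0 (le_trans _ (oneDsqr_ge1 x)).
    by rewrite ler_wpM2l ?ler_piMr ?cos_max// invr_ge0 (le_trans _ (oneDsqr_ge1 x)).
- by apply: (integrable_scale (g := fun x => `|tent x|)); exact/integrable_norm/integrable_tent.
move=> _ /integrable_measurable mg _.
have mf : measurable_fun setT fejer.
  have -> : fejer = (fun x => (\int[leb]_t (tent t * cos (t * x) * (oneDsqr x)^-1)) * oneDsqr x).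
    apply/funext => x; rewrite RintegralZr//; last exact: integrable_tent_cos.
    by rewrite mulfVK// gt_eqF// (lt_le_trans _ (oneDsqr_ge1 x)).
  apply: measurable_funM => //; exact: continuous_measurable_fun (@continuous_oneDsqr R).
have := integrable_scale (fejer 0 + 2) iO; apply: integrable_le => // x.
by rewrite ger0_norm ?fejer_ge0// mulrC fejer_le.
Qed.

(* The Fourier transform of [fejer] is supported in [-1, 1], so a kernel with
   characteristic function 1 there reproduces it under convolution. *)
Lemma conv_fejer (k : R -> R) (M : R) : leb.-integrable setT (EFin \o k) ->
  (forall x, `|k x| <= M) ->
  (forall t, 0 <= t <= 1 -> charRe k t = 1 /\ charIm k t = 0) ->
  conv fejer k =1 fejer.
Proof.
move=> ik kM char1 x.
have mk := integrable_measurable ik.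
have mt : measurable_fun setT tent := integrable_measurable integrable_tent.
rewrite convC; last exact: (integrable_conv_integrand integrable_fejer ik kM).
pose F y t := k y * (tent t * cos (t * (x - y))).
have mcx t : measurable_fun setT (fun y : R => tent t * cos (t * (x - y))).
  by apply: measurable_funM => //; exact: (measurable_reflect x (measurable_cosM t)).
have bcx t y : `|tent t * cos (t * (x - y))| <= `|tent t|.
  by rewrite normrM ler_piMr// cos_max.
have iF t : leb.-integrable setT (EFin \o F ^~ t).
  exact: (integrable_mul_bounded ik (mcx t) (bcx t)).
have [] := @Rfubini R F (fun t => `|tent t| * \int[leb]_y `|k y|).
- apply: measurable_funM; first exact: measurableT_comp.
  apply: measurable_funM; first exact: measurableT_comp.
  apply: (measurableT_comp (continuous_measurable_fun (@continuous_cos R))).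
  by apply: measurable_funM => //; apply: measurable_funB.
- move=> y; have := integrable_scale (k y) (integrable_tent_cos (x - y)).
  by apply: eq_integrable => // t _; rewrite /= mulrC.
- exact: iF.
- move=> t; rewrite mulrC -RintegralZr//; last exact: integrable_norm.
  apply: le_Rintegral => //; first exact: integrable_norm.
    by apply: (integrable_scale (g := fun x => `|k x|)); exact: integrable_norm.
  by move=> y _; rewrite normrM ler_wpM2l.
- by apply: (integrable_scale (g := fun x => `|tent x|)); exact/integrable_norm/integrable_tent.
move=> E _ _.
transitivity (\int[leb]_y \int[leb]_t F y t).
  by apply: eq_Rintegral => y _; rewrite RintegralZl//; exact: integrable_tent_cos.
rewrite E; apply: eq_Rintegral => t _.
have [t01|t01] := boolP (0 <= t <= 1); last first.
  rewrite /F /tent (negPf t01) mul0r; under eq_Rintegral do rewrite mul0r mulr0.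
  by rewrite Rintegral_cst// mul0r.
have [cR cI] := char1 t t01.
have i1 := integrable_mul_bounded ik (measurable_cosM t) (fun x => cos_max _).
have i2 := integrable_mul_bounded ik (measurable_sinM t) (fun x => sin_max _).
transitivity (\int[leb]_y (k y * cos (t * y) * (tent t * cos (t * x)) +
   k y * sin (t * y) * (tent t * sin (t * x)))).
  by apply: eq_Rintegral => y _; rewrite /F mulrBr cosB; ring.
rewrite RintegralD//; [|exact: integrable_scale..].
rewrite !RintegralZr//.
have -> : \int[leb]_y (k y * cos (t * y)) = 1.
  by rewrite -cR; apply: eq_Rintegral => y _; rewrite mulrC.
have -> : \int[leb]_y (k y * sin (t * y)) = 0.
  by rewrite -cI; apply: eq_Rintegral => y _; rewrite mulrC.
by rewrite mul1r mul0r addr0.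
Qed.

End Fejer.

(** * Bias-variance formula for the kernel estimator *)

Section Risk.
Variable R : realType.
Local Notation leb := (@lebesgue_measure R).

Lemma MISE_bias_variance (n : nat) (f K : R -> R) (M h : R) : (0 < n)%N ->
  is_density f -> L2 f -> leb.-integrable setT (EFin \o K) ->
  (forall x, `|K x| <= M) -> 0 < h ->
  MISE n f K h = (\int[leb]_x (conv f (Kh K h) x - f x) ^+ 2 +
    n%:R^-1 * ((\int[leb]_x K x ^+ 2) / h - \int[leb]_x conv f (Kh K h) x ^+ 2))%:E.
Proof.
move=> n0 df /L2_integrable f2 intK KM h0.
rewrite -(Rintegral_Kh_sqr intK h0 KM).
exact: (iid_expect_risk df f2 (integrable_Kh intK h0) (Kh_bounded h0 KM) n0).
Qed.

End Risk.

(** * A positive [S_K] gives the exact order for the normalised Fejer density *)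

Section Sufficiency.
Variable R : realType.
Local Notation leb := (@lebesgue_measure R).

Let mass : R := \int[leb]_x fejer x.

(** A nonnegative function of zero mass vanishes almost everywhere, whereas [fejer] is positive off
    the zeros of the sine. *)
Lemma fejer_mass_gt0 : 0 < mass.
Proof.
rewrite lt_def Rintegral_ge0 ?andbT; last by move=> x _; exact: fejer_ge0.
apply/eqP => /(Rintegral_eq0_ae (integrable_fejer R) (@fejer_ge0 R)) H.
have [x [s0 fx0]] := ae_exists (ae_filterS2 (fun x a b => conj a b) (@ae_sin_neq0 R) H).
by have := fejer_gt0 s0; rewrite fx0 ltxx.
Qed.

Definition fejer_density (x : R) : R := fejer x / mass.

Lemma integrable_fejer_density : leb.-integrable setT (EFin \o fejer_density).
Proof. exact: integrable_scale (integrable_fejer R). Qed.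

Lemma fejer_density_ge0 x : 0 <= fejer_density x.
Proof. by rewrite divr_ge0 ?fejer_ge0// ltW// fejer_mass_gt0. Qed.

Lemma is_density_fejer : is_density fejer_density.
Proof.
split; [exact: (integrable_measurable integrable_fejer_density)|exact: fejer_density_ge0|].
rewrite -EFin_Rintegral; last exact: integrable_fejer_density.
rewrite RintegralZr//; last exact: integrable_fejer.
by rewrite mulfV// gt_eqF// fejer_mass_gt0.
Qed.

Lemma fejer_density_le x : fejer_density x <= fejer_density 0.
Proof. by rewrite ler_pM2r ?invr_gt0 ?fejer_mass_gt0// fejer_le0. Qed.

Lemma fejer_density_even x : fejer_density (- x) = fejer_density x.
Proof. by rewrite /fejer_density fejer_even. Qed.

Lemma ae_fejer_density_gt0 : {ae leb, forall x, 0 < fejer_density x}.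
Proof.
apply: ae_filterS (@ae_sin_neq0 R) => x sx.
by rewrite divr_gt0 ?fejer_gt0// fejer_mass_gt0.
Qed.

Lemma fejer_density_L2 : L2 fejer_density.
Proof.
split; first exact: (integrable_measurable integrable_fejer_density).
have H x : `|fejer_density x| <= fejer_density 0.
  by rewrite ger0_norm ?fejer_density_le// fejer_density_ge0.
exact: (integrable_lty measurableT (integrable_sqr integrable_fejer_density H)).
Qed.

Lemma conv_fejer_density (k : R -> R) (M : R) : leb.-integrable setT (EFin \o k) ->
  (forall x, `|k x| <= M) ->
  (forall t, 0 <= t <= 1 -> charRe k t = 1 /\ charIm k t = 0) ->
  conv fejer_density k =1 fejer_density.
Proof.
move=> ik kM char1 x; rewrite /fejer_density -(conv_fejer ik kM char1) -RintegralZr//.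
  by apply: eq_Rintegral => y _; rewrite mulrAC.
exact: (integrable_conv_integrand (integrable_fejer R) ik kM).
Qed.

Lemma char1_below_S_K (K : R -> R) (t : R) : 0 <= t -> t < S_K K ->
  charRe K t = 1 /\ charIm K t = 0.
Proof.
move=> t0 tS; apply: contrapT => /not_andP nt.
have : S_K K <= t.
  apply: ge_inf; last by split.
  by exists 0 => s [].
by rewrite leNgt tS.
Qed.

Lemma Phi_fejer_exact_order (K : R -> R) (M : R) :
  leb.-integrable setT (EFin \o K) -> (forall x, `|K x| <= M) -> 0 < S_K K ->
  exact_order_inv_n (fun n => Phi n fejer_density K).
Proof.
move=> intK KM S0; set f := fejer_density.
have df : is_density f := is_density_fejer.
have f2 : L2 f := fejer_density_L2.
pose c := \int[leb]_x f x ^+ 2 - \int[leb]_x conv f f x ^+ 2.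
(* Halving keeps [t * h] strictly below [S_K K] up to and including [t = 1], the edge of the
   spectrum of the density. *)
pose h := S_K K / 2; have h0 : 0 < h by rewrite divr_gt0.
pose W := (\int[leb]_x K x ^+ 2) / h.
have W0 : 0 <= W.
  by apply: divr_ge0 (ltW h0); apply: Rintegral_ge0 => x _; exact: sqr_ge0.
have c0 : 0 < c.
  rewrite subr_gt0.
  exact: (conv_self_norm_lt df fejer_density_le ae_fejer_density_gt0).
(* The upper bound obtained is at most [W / n]; adding [c] secures [c <= C]. *)
exists c, (c + W), 1%N; split; rewrite ?lerDl// => n n1.
have n0 : 0 < n%:R :> R by rewrite ltr0n.
split.
- apply/ereal_infP => _ [r /= r0 <-].
  rewrite (MISE_bias_variance n1 df f2 intK KM r0) lee_fin mulrC.
  rewrite -(Rintegral_Kh_sqr intK r0 KM).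
  exact: (risk_ge df (L2_integrable f2) (integrable_Kh intK r0) (Kh_bounded r0 KM) n1
    fejer_density_le fejer_density_even).
- apply: (@le_trans _ _ (MISE n f K h)); first by apply: ereal_inf_lbound; exists h.
  rewrite (MISE_bias_variance n1 df f2 intK KM h0) lee_fin -/W.
  have E : conv f (Kh K h) =1 f.
    apply: (conv_fejer_density (integrable_Kh intK h0) (Kh_bounded h0 KM)) => t /andP[t0 t1].
    rewrite charRe_Kh// charIm_Kh//; apply: char1_below_S_K.
      by rewrite mulr_ge0// ltW.
    apply: (@le_lt_trans _ _ (1 * h)); first by rewrite ler_pM2r.
    by rewrite mul1r /h ltr_pdivrMr// mulr_natr mulr2n ltrDl.
  have -> : \int[leb]_x (conv f (Kh K h) x - f x) ^+ 2 = 0.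
    under eq_Rintegral do rewrite E subrr expr0n /=.
    by rewrite Rintegral_cst// mul0r.
  rewrite add0r mulrC ler_pM2r ?invr_gt0// lerBlDr -addrA [W + _]addrC addrA lerDr.
  apply: addr_ge0; first exact: ltW.
  by apply: Rintegral_ge0 => x _; exact: sqr_ge0.
Qed.

End Sufficiency.

(** * Dominated convergence for pairings with a varying bandwidth *)

Section Limits.
Variable R : realType.
Local Notation leb := (@lebesgue_measure R).

Lemma Rintegral_cvg (g_ : nat -> R -> R) (g b : R -> R) :
  (forall n, measurable_fun setT (g_ n)) -> measurable_fun setT g ->
  leb.-integrable setT (EFin \o b) -> (forall n x, `|g_ n x| <= b x) ->
  {ae leb, forall x, g_ n x @[n --> \oo] --> g x} ->
  \int[leb]_x g_ n x @[n --> \oo] --> \int[leb]_x g x.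
Proof.
move=> mg_ mg ib gb gg.
have mE_ n : measurable_fun setT (EFin \o g_ n) by exact/measurable_EFinP.
have mE : measurable_fun setT (EFin \o g) by exact/measurable_EFinP.
have gg' : {ae leb, forall x, setT x -> (EFin \o g_ n) x @[n --> \oo] --> (EFin \o g) x}.
  apply: (@ae_filterS _ (fun x => g_ n x @[n --> \oo] --> g x) _ _ gg) => x gx _.
  by apply/fine_cvgP; split; [exact: nearW|exact: gx].
have gb' : {ae leb, forall x n, setT x -> (`|(EFin \o g_ n) x| <= (EFin \o b) x)%E}.
  by apply: aeW => x n _; rewrite lee_fin.
have [ig _ H] := @dominated_convergence _ _ R leb setT measurableT (fun n => EFin \o g_ n) (EFin \o g) (EFin \o b) mE_ mE gg' ib gb'.
apply: fine_cvg; rewrite EFin_Rintegral//; exact: H.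
Qed.

Variables (f K : R -> R) (M : R).
Hypotheses (intf : leb.-integrable setT (EFin \o f))
  (intK : leb.-integrable setT (EFin \o K)) (KM : forall x, `|K x| <= M).

(* [E psi(X + h U)] for independent [X] and [U] with (signed) densities [f] and [K]. *)
Definition smooth_mean (psi : R -> R) (h : R) : R :=
  \int[leb]_y (f y * \int[leb]_u (K u * psi (y + h * u))).

Lemma measurable_comp_affine (psi : R -> R) (y h : R) : measurable_fun setT psi ->
  measurable_fun setT (fun u : R => psi (y + h * u)).
Proof.
by move=> mpsi; apply: (measurableT_comp mpsi); apply: measurable_funD.
Qed.

Lemma integrable_smooth_inner (psi : R -> R) (N y h : R) : measurable_fun setT psi ->
  (forall x, `|psi x| <= N) ->
  leb.-integrable setT (EFin \o (fun u => K u * psi (y + h * u))).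
Proof.
by move=> mpsi psiN; apply: (integrable_mul_bounded (N := N)) => //; exact: measurable_comp_affine.
Qed.

(** The substitution [x = y + h * u] moves the bandwidth from the kernel to the test function, so
    continuity of [psi] can replace that of [K] when [h] varies. *)
Lemma smooth_meanE (psi : R -> R) (N h : R) : 0 < h -> measurable_fun setT psi ->
  (forall x, `|psi x| <= N) ->
  smooth_mean psi h = \int[leb]_x (conv f (Kh K h) x * psi x) /\
  leb.-integrable setT
    (EFin \o (fun y => f y * \int[leb]_u (K u * psi (y + h * u)))).
Proof.
move=> h0 mpsi psiN.
have [E _ I] := conv_fubini intf (integrable_Kh intK h0) (Kh_bounded h0 KM) mpsi psiN.
have E' : (fun y => f y * \int[leb]_x (Kh K h (x - y) * psi x)) =
    (fun y => f y * \int[leb]_u (K u * psi (y + h * u))).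
  by apply/funext => y; rewrite (Rintegral_Kh_mul intK h0 y mpsi psiN).
by rewrite E' in I; rewrite E; split => //; rewrite /smooth_mean; congr Rintegral.
Qed.

(** Dominated convergence in [u] and then in [y]. It is applied once with [psi] fixed and [h_]
    convergent, once with [h] fixed and damped test functions. *)
Lemma smooth_mean_cvg (psi_ : nat -> R -> R) (psi : R -> R) (h_ : nat -> R) (h N : R) :
  (forall n, measurable_fun setT (psi_ n)) -> measurable_fun setT psi ->
  (forall n x, `|psi_ n x| <= N) -> (forall x, `|psi x| <= N) ->
  (forall n, 0 < h_ n) -> 0 < h ->
  (forall y u, psi_ n (y + h_ n * u) @[n --> \oo] --> psi (y + h * u)) ->
  smooth_mean (psi_ n) (h_ n) @[n --> \oo] --> smooth_mean psi h.
Proof.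
move=> mpsi_ mpsi psiN_ psiN h_0 h0 H.
apply: (Rintegral_cvg (b := fun y => `|f y| * (N * \int[leb]_u `|K u|))).
- by move=> n; exact: (integrable_measurable (smooth_meanE (h_0 n) (mpsi_ n) (psiN_ n)).2).
- exact: (integrable_measurable (smooth_meanE h0 mpsi psiN).2).
- by apply: (integrable_scale (g := fun y => `|f y|)); exact: integrable_norm.
- move=> n y; rewrite normrM ler_wpM2l//.
  apply: (le_trans (le_normr_Rintegral _ (integrable_smooth_inner _ _ (mpsi_ n) (psiN_ n)))) => //.
  rewrite mulrC -RintegralZr//; last exact: integrable_norm.
  apply: le_Rintegral => //.
  + exact: integrable_norm (integrable_smooth_inner _ _ (mpsi_ n) (psiN_ n)).
  + by apply: (integrable_scale (g := fun y => `|K y|)); exact: integrable_norm.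
  + by move=> u _; rewrite normrM ler_wpM2l.
- apply: aeW => y; apply: cvgM; first exact: cvg_cst.
  apply: (Rintegral_cvg (b := fun u => `|K u| * N)).
  + by move=> n; exact: (integrable_measurable (integrable_smooth_inner _ _ (mpsi_ n) (psiN_ n))).
  + exact: (integrable_measurable (integrable_smooth_inner _ _ mpsi psiN)).
  + by apply: (integrable_scale (g := fun y => `|K y|)); exact: integrable_norm.
  + by move=> n u; rewrite normrM ler_wpM2l.
  + by apply: aeW => u; apply: cvgM; [exact: cvg_cst|exact: H].
Qed.

(** Addition formula for the cosine: the right side is the real part of [phi_f(t) * phi_K(t * h)].
    The sine version below gives the imaginary part. *)
Lemma smooth_mean_cos (t h : R) :
  smooth_mean (fun x => cos (t * x)) h =
  charRe f t * charRe K (t * h) - charIm f t * charIm K (t * h).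
Proof.
have i1 := integrable_mul_bounded intK (measurable_cosM (t * h)) (fun x => cos_max _).
have i2 := integrable_mul_bounded intK (measurable_sinM (t * h)) (fun x => sin_max _).
have j1 := integrable_mul_bounded intf (measurable_cosM t) (fun x => cos_max _).
have j2 := integrable_mul_bounded intf (measurable_sinM t) (fun x => sin_max _).
have c1 : charRe K (t * h) = \int[leb]_x (K x * cos (t * h * x)).
  by apply: eq_Rintegral => x _; rewrite mulrC.
have c2 : charIm K (t * h) = \int[leb]_x (K x * sin (t * h * x)).
  by apply: eq_Rintegral => x _; rewrite mulrC.
have c3 : charRe f t = \int[leb]_x (f x * cos (t * x)).
  by apply: eq_Rintegral => x _; rewrite mulrC.
have c4 : charIm f t = \int[leb]_x (f x * sin (t * x)).
  by apply: eq_Rintegral => x _; rewrite mulrC.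
rewrite [in LHS]/smooth_mean.
transitivity (\int[leb]_y (f y * cos (t * y) * charRe K (t * h) -
    f y * sin (t * y) * charIm K (t * h))).
  apply: eq_Rintegral => y _.
  have -> : \int[leb]_u (K u * cos (t * (y + h * u))) =
      \int[leb]_u (K u * cos (t * h * u) * cos (t * y) - K u * sin (t * h * u) * sin (t * y)).
    by apply: eq_Rintegral => u _; rewrite mulrDr cosD mulrA; ring.
  rewrite RintegralB//; [|exact: integrable_scale..].
  rewrite !RintegralZr// -c1 -c2; ring.
rewrite RintegralB//; [|exact: integrable_scale..].
by rewrite !RintegralZr// -c3 -c4.
Qed.

Lemma smooth_mean_sin (t h : R) :
  smooth_mean (fun x => sin (t * x)) h =
  charIm f t * charRe K (t * h) + charRe f t * charIm K (t * h).
Proof.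
have i1 := integrable_mul_bounded intK (measurable_cosM (t * h)) (fun x => cos_max _).
have i2 := integrable_mul_bounded intK (measurable_sinM (t * h)) (fun x => sin_max _).
have j1 := integrable_mul_bounded intf (measurable_cosM t) (fun x => cos_max _).
have j2 := integrable_mul_bounded intf (measurable_sinM t) (fun x => sin_max _).
have c1 : charRe K (t * h) = \int[leb]_x (K x * cos (t * h * x)).
  by apply: eq_Rintegral => x _; rewrite mulrC.
have c2 : charIm K (t * h) = \int[leb]_x (K x * sin (t * h * x)).
  by apply: eq_Rintegral => x _; rewrite mulrC.
have c3 : charRe f t = \int[leb]_x (f x * cos (t * x)).
  by apply: eq_Rintegral => x _; rewrite mulrC.
have c4 : charIm f t = \int[leb]_x (f x * sin (t * x)).
  by apply: eq_Rintegral => x _; rewrite mulrC.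
rewrite [in LHS]/smooth_mean.
transitivity (\int[leb]_y (f y * sin (t * y) * charRe K (t * h) +
    f y * cos (t * y) * charIm K (t * h))).
  apply: eq_Rintegral => y _.
  have -> : \int[leb]_u (K u * sin (t * (y + h * u))) =
      \int[leb]_u (K u * cos (t * h * u) * sin (t * y) + K u * sin (t * h * u) * cos (t * y)).
    by apply: eq_Rintegral => u _; rewrite mulrDr sinD mulrA; ring.
  rewrite RintegralD//; [|exact: integrable_scale..].
  rewrite !RintegralZr// -c1 -c2; ring.
rewrite RintegralD//; [|exact: integrable_scale..].
by rewrite !RintegralZr// -c3 -c4.
Qed.

End Limits.

(** * Characteristic functions near the origin and away from it *)

Section NearOrigin.
Variable R : realType.
Local Notation leb := (@lebesgue_measure R).

Lemma Rintegral_sqr_gt0 (g : R -> R) : leb.-integrable setT (EFin \o g) ->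
  leb.-integrable setT (EFin \o (fun x => g x ^+ 2)) ->
  \int[leb]_x g x != 0 -> 0 < \int[leb]_x g x ^+ 2.
Proof.
move=> ig ig2 gn0; rewrite ltNge; apply: contra gn0 => g20; apply/eqP.
have g0 : \int[leb]_x g x ^+ 2 = 0.
  by apply/eqP; rewrite eq_le g20 Rintegral_ge0// => x _; exact: sqr_ge0.
have H := Rintegral_eq0_ae ig2 (fun x => sqr_ge0 (g x)) g0.
rewrite /Rintegral (ae_eq_integral (cst 0%E))//; first by rewrite integral0.
  exact: measurable_int ig.
by apply: (@ae_filterS _ _ (fun x => setT x -> (g x)%:E = 0%E) _ H) => x /eqP; rewrite sqrf_eq0 => /eqP ->.
Qed.

(* If [charRe K] were 1 on the whole half-line, then expanding [cos x ^+ N] as a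
   trigonometric polynomial would give [\int K cos^N = 1] for all [N]. *)
Lemma charRe_ne1 (K : R -> R) : leb.-integrable setT (EFin \o K) ->
  exists t, 0 <= t /\ charRe K t <> 1.
Proof.
move=> iK; apply: contrapT => /forallNP nK.
have K1 t : 0 <= t -> charRe K t = 1.
  by move=> t0; apply: contrapT => H; apply: (nK t).
have iKc (N : nat) t : leb.-integrable setT
    (EFin \o (fun x => K x * (cos x ^+ N * cos (t * x)))).
  apply: (integrable_mul_bounded (N := 1)) => //.
    apply: measurable_funM; last exact: measurable_cosM.
    by apply: measurable_funX; exact: continuous_measurable_fun (@continuous_cos R).
  by move=> x; rewrite normrM normrX mulr_ile1 ?exprn_ile1 ?cos_max.
(* The extra frequency [t] closes the induction: [cos x * cos (t * x)] is the average of the cosines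
   of frequencies [t + 1] and [t - 1]. Negative frequencies reduce to positive ones by evenness. *)
have E (N : nat) t : \int[leb]_x (K x * (cos x ^+ N * cos (t * x))) = 1.
  elim: N t => [|N IH] t.
    rewrite -(K1 `|t|)//; apply: eq_Rintegral => x _; rewrite expr0 mul1r mulrC.
    by have [t0|t0] := lerP 0 t; rewrite ?(ger0_norm t0) ?(ltr0_norm t0) ?mulNr ?cosN.
  transitivity (\int[leb]_x (K x * (cos x ^+ N * cos ((t + 1) * x)) * 2^-1 +
      K x * (cos x ^+ N * cos ((t - 1) * x)) * 2^-1)).
    by apply: eq_Rintegral => x _; rewrite mulrDl mulrBl mul1r cosD cosB exprS; field.
  rewrite RintegralD//; [|exact: integrable_scale..].
  rewrite !RintegralZr// !IH; lra.
(* These integrals all equal 1, yet they tend to 0 because [|cos x| < 1] almost everywhere. *)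
have : \int[leb]_x (K x * (cos x ^+ n * cos (0 * x))) @[n --> \oo] --> \int[leb]_x (0 : R).
  apply: (Rintegral_cvg (b := fun x => `|K x|)).
  - by move=> n; exact: integrable_measurable (iKc n 0).
  - exact: measurable_cst.
  - exact: integrable_norm.
  - move=> n x; rewrite normrM ler_piMr// normrM normrX mulr_ile1 ?exprn_ile1 ?cos_max//.
  - apply: ae_filterS (@ae_sin_neq0 R) => x sx.
    have cx : `|cos x| < 1.
      by rewrite lt_neqAle cos_max andbT norm_cos_eq1.
    rewrite mul0r cos0 -[X in _ --> X](mulr0 (K x)).
    apply: cvgM; first exact: cvg_cst.
    by under eq_fun do rewrite mulr1; exact: cvg_expr.
rewrite Rintegral_cst// mul0r; under eq_fun do rewrite E.
move=> H; have : 1 <= 0 :> R.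
  by apply: (ler_cvg_to (cvg_cst (1 : R)) H); exact: nearW.
by rewrite ler10.
Qed.

(** Continuity at 0 by sequences: points [t_ n] in [[0, 1 / (n + 1)]] with nonpositive real part
    would contradict the limit [\int f = 1]. *)
Lemma charRe_gt0_near0 (f : R -> R) : leb.-integrable setT (EFin \o f) ->
  \int[leb]_x f x = 1 ->
  exists2 d : R, 0 < d & forall t, 0 <= t <= d -> 0 < charRe f t.
Proof.
move=> intf f1; apply: contrapT => H.
have /choice[t_ t_P] : forall n : nat, exists t, 0 <= t <= n.+1%:R^-1 /\ charRe f t <= 0.
  move=> n; apply: contrapT => /forallNP nt; apply: H; exists n.+1%:R^-1; first by rewrite invr_gt0.
  by move=> t tn; rewrite ltNge; apply/negP => ft; apply: (nt t).
have t0 : t_ n @[n --> \oo] --> (0 : R).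
  apply: (@squeeze_cvgr _ _ _ _ (cst 0) (fun n => n.+1%:R^-1)).
  - by apply: nearW => n; exact: (t_P n).1.
  - exact: cvg_cst.
  - exact: cvg_harmonic.
have : charRe f (t_ n) @[n --> \oo] --> \int[leb]_x f x.
  apply: (Rintegral_cvg (b := fun x => `|f x|)).
  - move=> n; apply: measurable_funM; first exact: measurable_cosM.
    exact: integrable_measurable.
  - exact: integrable_measurable.
  - exact: integrable_norm.
  - by move=> n x; rewrite normrM ler_piMl// cos_max.
  - apply: aeW => x; rewrite -[X in _ --> X]mul1r; apply: cvgM; last exact: cvg_cst.
    have : cos (t_ n * x) @[n --> \oo] --> cos (0 * x).
      by apply: continuous_cvg; [exact: continuous_cos|apply: cvgM => //; exact: cvg_cst].
    by rewrite mul0r cos0.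
rewrite f1 => H1.
have : 1 <= 0 :> R.
  by apply: (ler_cvg_to H1 (cvg_cst 0)); apply: nearW => n; exact: (t_P n).2.
by rewrite ler10.
Qed.

End NearOrigin.

(** * Consequences of a bias tending to 0 along convergent bandwidths *)

Section VanishingBias.
Variable R : realType.
Local Notation leb := (@lebesgue_measure R).
Variables (f K : R -> R) (M : R).
Hypotheses (df : is_density f)
  (f2 : leb.-integrable setT (EFin \o (fun x => f x ^+ 2)))
  (intK : leb.-integrable setT (EFin \o K)) (KM : forall x, `|K x| <= M).

Let intf := integrable_density df.

Definition bias2 (h : R) : R := \int[leb]_x (conv f (Kh K h) x - f x) ^+ 2.

Variables (h_ : nat -> R) (h : R).
Hypotheses (h_0 : forall n, 0 < h_ n) (h0 : 0 < h) (h_h : h_ n @[n --> \oo] --> h)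
  (bias0 : bias2 (h_ n) @[n --> \oo] --> (0 : R)).

(** The error paired with [psi] tends to 0 by Cauchy-Schwarz, while the pairings of
    [f * Kh K (h_ n)] converge to [smooth_mean f K psi h]. *)
Lemma smooth_mean_L2 (psi : R -> R) (N : R) : continuous psi ->
  (forall x, `|psi x| <= N) ->
  leb.-integrable setT (EFin \o (fun x => psi x ^+ 2)) ->
  smooth_mean f K psi h = \int[leb]_x (f x * psi x).
Proof.
move=> cpsi psiN psi2; have mpsi := continuous_measurable_fun cpsi.
pose P := \int[leb]_x psi x ^+ 2.
have P0 : 0 <= P by apply: Rintegral_ge0 => x _; exact: sqr_ge0.
pose b_ n := smooth_mean f K psi (h_ n) - \int[leb]_x (f x * psi x).
pose b := smooth_mean f K psi h - \int[leb]_x (f x * psi x).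
have b_b : b_ n @[n --> \oo] --> b.
  apply: cvgB; last exact: cvg_cst.
  apply: (smooth_mean_cvg intf intK KM (N := N)) => // y u.
  apply: continuous_cvg; first exact: cpsi.
  apply: cvgD; first exact: cvg_cst.
  by apply: cvgM => //; exact: cvg_cst.
have ifpsi := integrable_mul_bounded intf mpsi psiN.
(* the quadratic [l |-> \int (g - l psi)^2], [g] being the error, is nonnegative *)
have quad n (l : R) : 2 * (l * b_ n) <= bias2 (h_ n) + l ^+ 2 * P.
  set k := Kh K (h_ n).
  have ik := integrable_Kh intK (h_0 n).
  have kM := Kh_bounded (h_0 n) KM.
  have iG := integrable_conv intf ik kM.
  have G2 := integrable_conv_sqr df ik kM.
  have mf := integrable_measurable intf.
  have mG := integrable_measurable iG.
  have g2 := integrable_sqr_sub mG mf G2 f2.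
  have mg : measurable_fun setT (fun x => conv f k x - f x) by exact: measurable_funB.
  have l2 : leb.-integrable setT (EFin \o (fun x => (psi x * l) ^+ 2)).
    have := integrable_scale (l ^+ 2) psi2.
    by apply: eq_integrable => // x _; rewrite /= exprMn.
  have ml : measurable_fun setT (fun x => psi x * l) by exact: measurable_funM.
  have := Rintegral_sqr_sub mg ml g2 l2.
  have iGpsi := integrable_mul_bounded iG mpsi psiN.
  have -> : \int[leb]_x ((conv f k x - f x) * (psi x * l)) = l * b_ n.
    rewrite /b_ (smooth_meanE intf intK KM (h_0 n) mpsi psiN).1 -RintegralB// mulrC.
    rewrite -RintegralZr//; last exact: integrable_sub.
    by apply: eq_Rintegral => x _; ring.
  have -> : \int[leb]_x (psi x * l) ^+ 2 = l ^+ 2 * P.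
    by rewrite mulrC -RintegralZr//; apply: eq_Rintegral => x _; rewrite exprMn.
  have : 0 <= \int[leb]_x (conv f k x - f x - psi x * l) ^+ 2.
    by apply: Rintegral_ge0 => x _; exact: sqr_ge0.
  rewrite -/(bias2 (h_ n)); lra.
(* The minimiser of the limiting quadratic would be [b / P]; the added 1 allows [P = 0]. The limit
   inequality becomes [2 * l^2 * (P + 1) <= l^2 * P], hence [l = 0]. *)
pose l := b / (P + 1).
have P1 : 0 < P + 1 by rewrite ltr_wpDl.
have : 2 * (l * b) <= 0 + l ^+ 2 * P.
  have c1 : 2 * (l * b_ n) @[n --> \oo] --> 2 * (l * b).
    by apply: cvgM; [exact: cvg_cst|apply: cvgM => //; exact: cvg_cst].
  have c2 : bias2 (h_ n) + l ^+ 2 * P @[n --> \oo] --> 0 + l ^+ 2 * P.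
    by apply: cvgD => //; exact: cvg_cst.
  by apply: (ler_cvg_to c1 c2); apply: nearW => n; exact: quad.
have bE : b = l * (P + 1) by rewrite /l divfK// gt_eqF.
rewrite bE add0r => H.
have l0 : l ^+ 2 = 0.
  by apply/eqP; rewrite eq_le sqr_ge0 andbT; have := sqr_ge0 l; nra.
apply/eqP; rewrite -subr_eq0 -/b bE; move/eqP: l0; rewrite sqrf_eq0 => /eqP ->.
by rewrite mul0r.
Qed.

(** Multiplying [psi] by [1 / (1 + (x / (n + 1))^2)] makes it square integrable without raising its
    bound; both sides then converge by domination as [n] grows. *)
Lemma smooth_mean_bounded (psi : R -> R) (N : R) : continuous psi ->
  (forall x, `|psi x| <= N) ->
  smooth_mean f K psi h = \int[leb]_x (f x * psi x).
Proof.
move=> cpsi psiN; have mpsi := continuous_measurable_fun cpsi.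
have N0 : 0 <= N := le_trans (normr_ge0 _) (psiN 0).
pose w n (x : R) : R := (oneDsqr (n.+1%:R^-1 * x + 0))^-1.
have cO := @continuous_oneDsqrV R.
have cw n : continuous (w n).
  move=> x; have ca : n.+1%:R^-1 * y + 0 @[y --> x] --> n.+1%:R^-1 * x + 0.
    by apply: cvgD; [exact: mulrl_continuous|exact: cvg_cst].
  exact: cvg_comp ca (cO _).
have w1 n x : `|w n x| <= 1.
  by rewrite ger0_norm ?oneDsqrV_le1// invr_ge0 (le_trans _ (oneDsqr_ge1 _)).
have iw n : leb.-integrable setT (EFin \o w n).
  have n0 : n.+1%:R^-1 != 0 :> R by rewrite invr_neq0.
  exact: (integrable_affine 0 n0 (integrable_oneDsqrV R)).
have ww x : psi x * w n x @[n --> \oo] --> psi x.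
  rewrite -[X in _ --> X]mulr1; apply: cvgM; first exact: cvg_cst.
  have ca : n.+1%:R^-1 * x + 0 @[n --> \oo] --> (0 * x + 0 : R).
    apply: cvgD; last exact: cvg_cst.
    by apply: cvgM; [exact: cvg_harmonic|exact: cvg_cst].
  have <- : (oneDsqr (0 * x + 0))^-1 = 1 :> R.
    by rewrite mul0r addr0 /oneDsqr expr0n addr0 invr1.
  exact: (cvg_comp _ _ ca (cO (0 * x + 0))).
pose psi_ n x := psi x * w n x.
have cpsi_ n : continuous (psi_ n) by move=> x; apply: cvgM; [exact: cpsi|exact: cw].
have psi_N n x : `|psi_ n x| <= N.
  by rewrite normrM -[leRHS]mulr1 ler_pM.
have E n : smooth_mean f K (psi_ n) h = \int[leb]_x (f x * psi_ n x).
  apply: (smooth_mean_L2 (cpsi_ n) (psi_N n)).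
  have := integrable_mul_bounded (iw n) (continuous_measurable_fun (cpsi_ n)) (psi_N n).
  move=> i1; have := integrable_mul_bounded i1 mpsi psiN.
  by apply: eq_integrable => // x _; rewrite /psi_ /=; congr EFin; ring.
have L1 : smooth_mean f K (psi_ n) h @[n --> \oo] --> smooth_mean f K psi h.
  apply: (smooth_mean_cvg intf intK KM (h_ := cst h) (N := N)) => //.
  - by move=> n; exact: continuous_measurable_fun.
  - by move=> y u; exact: ww.
have L2 : \int[leb]_x (f x * psi_ n x) @[n --> \oo] --> \int[leb]_x (f x * psi x).
  apply: (Rintegral_cvg (b := fun x => `|f x| * N)).
  - move=> n; apply: measurable_funM; first exact: integrable_measurable.
    exact: continuous_measurable_fun.
  - by apply: measurable_funM => //; exact: integrable_measurable.
  - by apply: (integrable_scale (g := fun x => `|f x|)); exact: integrable_norm.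
  - by move=> n x; rewrite normrM ler_wpM2l.
  - by apply: aeW => x; apply: cvgM; [exact: cvg_cst|exact: ww].
rewrite (funext E) in L1.
exact: (cvg_unique _ L1 L2).
Qed.

Lemma char1_of_vanishing_bias (t : R) : 0 < charRe f t ->
  charRe K (t * h) = 1 /\ charIm K (t * h) = 0.
Proof.
move=> r0.
have cc : continuous (fun x : R => cos (t * x)).
  move=> x; apply: continuous_comp; [exact: mulrl_continuous|exact: continuous_cos].
have cs : continuous (fun x : R => sin (t * x)).
  move=> x; apply: continuous_comp; [exact: mulrl_continuous|exact: continuous_sin].
have := smooth_mean_bounded cc (fun x => cos_max _).
have := smooth_mean_bounded cs (fun x => sin_max _).
rewrite smooth_mean_cos// smooth_mean_sin//.
have -> : \int[leb]_x (f x * cos (t * x)) = charRe f t.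
  by apply: eq_Rintegral => x _; rewrite mulrC.
have -> : \int[leb]_x (f x * sin (t * x)) = charIm f t.
  by apply: eq_Rintegral => x _; rewrite mulrC.
move: r0; set r := charRe f t; set i := charIm f t.
set a := charRe K _; set b := charIm K _ => r0 e1 e2.
have ri : 0 < r ^+ 2 + i ^+ 2 by rewrite ltr_wpDr ?sqr_ge0// exprn_gt0.
have ri0 : r ^+ 2 + i ^+ 2 != 0 by rewrite gt_eqF.
(* The two equations say [phi_f(t) * (phi_K(t * h) - 1) = 0]. Multiplying by the conjugate of
   [phi_f(t)] isolates the real and imaginary parts of the second factor. *)
have : (r ^+ 2 + i ^+ 2) * (a - 1) = 0.
  have -> : (r ^+ 2 + i ^+ 2) * (a - 1) = r * (r * a - i * b - r) + i * (i * a + r * b - i) by ring.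
  by rewrite e1 e2 !subrr !mulr0 addr0.
have : (r ^+ 2 + i ^+ 2) * b = 0.
  have -> : (r ^+ 2 + i ^+ 2) * b = r * (i * a + r * b - i) - i * (r * a - i * b - r) by ring.
  by rewrite e1 e2 !subrr !mulr0 subr0.
move=> /eqP; rewrite mulf_eq0 (negPf ri0)/= => /eqP ->.
move=> /eqP; rewrite mulf_eq0 (negPf ri0)/= subr_eq0 => /eqP -> //.
Qed.

End VanishingBias.

(** * Extraction of a limiting bandwidth, and positivity of [S_K] *)

Section Necessity.
Variable R : realType.
Local Notation leb := (@lebesgue_measure R).

Lemma vanishing_bias_sequence (f K : R -> R) (M : R) : is_density f -> L2 f ->
  leb.-integrable setT (EFin \o K) -> \int[leb]_x K x = 1 -> (forall x, `|K x| <= M) ->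
  exact_order_inv_n (fun n => Phi n f K) ->
  exists (h_ : nat -> R) (h : R), [/\ forall n, 0 < h_ n, 0 < h,
    h_ n @[n --> \oo] --> h & bias2 f K (h_ n) @[n --> \oo] --> (0 : R)].
Proof.
move=> df f2 intK K1 KM [c [C0 [n0 [c0 cC0 HPhi]]]].
have intf := integrable_density df.
have f2i := L2_integrable f2.
(* [Phi] is an infimum: the extra 1 leaves strict room for a bandwidth whose risk is below
   [C / n]. *)
pose C := C0 + 1.
have C_gt0 : 0 < C by rewrite ltr_wpDl// (le_trans (ltW c0)).
pose P := \int[leb]_x f x ^+ 2.
pose kappa := \int[leb]_x K x ^+ 2.
have P0 : 0 < P by apply: Rintegral_sqr_gt0 => //; rewrite (Rintegral_density df) oner_neq0.
have k0 : 0 < kappa.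
  by apply: Rintegral_sqr_gt0 => //; [exact: integrable_sqr KM|rewrite K1 oner_neq0].
(* discarding the first [n1] sample sizes makes [bias2 <= P / 4] from the start *)
pose n1 := (n0 + Num.bound (4 * C / P)).+1.
have bound_h m : exists h, 0 < h /\ bias2 f K h +
    (m + n1)%:R^-1 * (kappa / h - \int[leb]_x conv f (Kh K h) x ^+ 2) < C / (m + n1)%:R.
  have n0m : (n0 <= m + n1)%N by rewrite /n1 addnS -addSn addnCA leq_addr.
  have mn1 : (0 < m + n1)%N by rewrite /n1 addnS.
  have [_ HU] := HPhi _ n0m.
  have : (Phi (m + n1) f K < (C / (m + n1)%:R)%:E)%E.
    by apply: (le_lt_trans HU); rewrite lte_fin ltr_pM2r ?invr_gt0 ?ltr0n// /C ltrDl.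
  move=> /ereal_inf_lt[_ [h /= h0 <-]].
  by rewrite (MISE_bias_variance mn1 df f2 intK KM h0) lte_fin => H; exists h.
have /choice[h_ h_P] := bound_h.
have h_0 m : 0 < h_ m := (h_P m).1.
(* The constants come from [||G||^2 <= 2 B + 2 P] and [P <= 2 B + 2 ||G||^2], with [B] the squared
   bias. The second fact bounds [h_ m] below, the third bounds it above. *)
have facts m : [/\ bias2 f K (h_ m) < C / (m + n1)%:R, kappa / h_ m <= 3 * C + 2 * P &
    P <= 2 * (C / (m + n1)%:R) + 2 * (kappa / h_ m)].
  have [hm0] := h_P m.
  set B := bias2 _ _ _; set N := \int[leb]_x _; set n := (m + n1)%N.
  have n_gt0 : 0 < n%:R :> R by rewrite ltr0n /n /n1 addnS.
  have n_ge1 : 1 <= n%:R :> R by rewrite ler1n /n /n1 addnS.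
  have ik := integrable_Kh intK hm0.
  have kM := Kh_bounded hm0 KM.
  have NW : N <= kappa / h_ m.
    by rewrite -(Rintegral_Kh_sqr intK hm0 KM); exact: (conv_norm_le df ik kM).
  have B0 : 0 <= B by apply: Rintegral_ge0 => x _; exact: sqr_ge0.
  have G2 := integrable_conv_sqr df ik kM.
  have mf := integrable_measurable intf.
  have mG := integrable_measurable (integrable_conv intf ik kM).
  have g2 := integrable_sqr_sub mG mf G2 f2i.
  have iB2 := integrable_scale 2 g2.
  have NB : N <= B * 2 + P * 2.
    rewrite /B /P -!RintegralZr// -RintegralD//; last exact: integrable_scale.
    apply: le_Rintegral => //; first by apply: integrable_add => //; exact: integrable_scale.
    by move=> x _; have := sqr_ge0 (conv f (Kh K (h_ m)) x - 2 * f x); nra.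
  have PB : P <= B * 2 + N * 2.
    rewrite /B /N -!RintegralZr// -RintegralD//; last exact: integrable_scale.
    apply: le_Rintegral => //; first by apply: integrable_add => //; exact: integrable_scale.
    by move=> x _; have := sqr_ge0 (2 * conv f (Kh K (h_ m)) x - f x); nra.
  move=> H.
  have BC : B < C / n%:R.
    by apply: le_lt_trans H; rewrite lerDl mulr_ge0 ?subr_ge0.
  have VC : kappa / h_ m - N < C.
    have : n%:R^-1 * (kappa / h_ m - N) < C / n%:R.
      by apply: le_lt_trans H; rewrite lerDr.
    by rewrite mulrC ltr_pM2r ?invr_gt0.
  have CC : C / n%:R <= C by rewrite ler_pdivrMr// ler_peMr// ltW.
  by split => //; lra.
have bias_small m : C / (m + n1)%:R <= P / 4.
  have n_gt0 : 0 < (m + n1)%:R :> R by rewrite ltr0n /n1 addnS.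
  have a0 : 0 <= 4 * C / P by rewrite divr_ge0 ?mulr_ge0 ?ltW.
  have : 4 * C / P <= (m + n1)%:R.
    rewrite (le_trans (ltW (archi_boundP a0)))// ler_nat.
    by rewrite /n1 addnS addnA ltnW// ltnS leq_addl.
  by rewrite ler_pdivrMr// ler_pdivrMr// => H; lra.
pose a := kappa / (3 * C + 2 * P).
have D0 : 0 < 3 * C + 2 * P by lra.
have a0 : 0 < a by rewrite divr_gt0.
have ah m : a <= h_ m.
  have [_ + _] := facts m.
  by rewrite /a !ler_pdivrMr// mulrC.
have hb m : h_ m <= 4 * kappa / P.
  have [_ _ +] := facts m; have := bias_small m => H1 H2.
  have : P / 4 <= kappa / h_ m by lra.
  by rewrite ler_pdivlMr// ler_pdivlMr// => H3; lra.
have [phi iphi /cvg_ex[h hh]] : exists2 phi : nat -> nat, increasing_seq phi & cvgn (h_ \o phi).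
  apply: bolzano_weierstrass; exists (4 * kappa / P); split; first exact: num_real.
  move=> x Hx m _ /=; rewrite ger0_norm; last exact: ltW.
  exact: le_trans (hb m) (ltW Hx).
exists (h_ \o phi), h; split => //.
- by move=> n; exact: h_0.
- apply: (lt_le_trans a0); apply: (ler_cvg_to (cvg_cst a) hh).
  by apply: nearW => n; exact: ah.
(* Subsequence indices dominate [n], so the bias along the subsequence is still at most
   [C / (n + 1)]. *)
- have phin n : (n <= phi n)%N.
    elim: n => // n IH; apply: (leq_ltn_trans IH).
    by rewrite ltnNge; have := iphi n.+1 n; rewrite ltnn => /negbT.
  apply: (@squeeze_cvgr _ _ _ _ (cst 0) (fun n => C * n.+1%:R^-1)).
  + apply: nearW => n; apply/andP; split.
      by apply: Rintegral_ge0 => x _; exact: sqr_ge0.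
    have [H _ _] := facts (phi n); apply: (le_trans (ltW H)).
    rewrite ler_pM2l// lef_pV2 ?posrE ?ltr0n// ?ler_nat.
      by rewrite /n1 addnS ltnS (leq_trans (phin n)) ?leq_addr.
    by rewrite /n1 addnS.
  + exact: cvg_cst.
  + by rewrite -[X in _ --> X](mulr0 C); apply: cvgM; [exact: cvg_cst|exact: cvg_harmonic].
Qed.

Lemma S_K_gt0_of_exact_order (f K : R -> R) (M : R) : is_density f -> L2 f ->
  leb.-integrable setT (EFin \o K) -> \int[leb]_x K x = 1 -> (forall x, `|K x| <= M) ->
  exact_order_inv_n (fun n => Phi n f K) -> 0 < S_K K.
Proof.
move=> df f2 intK K1 KM HPhi.
have [h_ [h [h_0 h0 hh b0]]] := vanishing_bias_sequence df f2 intK K1 KM HPhi.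
have [d d0 fd] := charRe_gt0_near0 (integrable_density df) (Rintegral_density df).
have [t [t0 Kt]] := charRe_ne1 intK.
apply: (@lt_le_trans _ _ (d * h)); first by rewrite mulr_gt0.
(* The infimum of the empty set is 0 by convention, so a point where [phi_K] differs from 1 must be
   exhibited; [charRe_ne1] supplies it. *)
apply: lb_le_inf; first by exists t; split => //; left.
move=> s [s0 sne]; rewrite leNgt; apply/negP => sd.
(* A point [s] below [d * h] is [t * h] with [t = s / h] in the range where [phi_f] has positive
   real part. *)
have sh : 0 <= s / h <= d by rewrite divr_ge0 ?(ltW h0)//= ler_pdivrMr// ltW.
have [] := char1_of_vanishing_bias df (L2_integrable f2) intK KM h_0 h0 hh b0 (fd _ sh).
by rewrite divfK ?gt_eqF// => e1 e2; case: sne.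
Qed.

End Necessity.

Theorem theorem2 (R : realType) (K : R -> R) :
  is_kernel K -> L2 K -> S_K K = T_K K ->
  (0 < S_K K <->
   exists f : R -> R, is_density f /\ L2 f /\
     exact_order_inv_n (fun n : nat => Phi n f K)).
Proof.
move=> [_ intK K1 [M KM] _] _ _; split.
- move=> S0; exists (@fejer_density R); split; first exact: is_density_fejer.
  split; first exact: fejer_density_L2.
  exact: Phi_fejer_exact_order intK KM S0.
- move=> [f [df [f2 HPhi]]].
  by apply: (S_K_gt0_of_exact_order df f2 intK _ KM HPhi); rewrite /Rintegral K1.
Qed.
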